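(* Let $X\subset\mathbb{R}^n$ be a nonempty orthosymmetric, quadratically convex, convex and compact set. Let $r\in[1,2]$, $\beta\in\mathbb{R}^n$ with all $\beta_j>0$, and $\gamma(g)=\|\beta\odot g\|_r$, where $(\beta\odot g)_j=\beta_jg_j$. Then for $k\ge2n$, $$\frac1{16}\frac1{\sqrt k}\sup_{x\in X}\|\mathrm{res}(x,\gamma)\|_2\ \le\ \mathfrak{M}^{\mathsf S}_k(X,\gamma)\ \le\ \mathfrak{M}^{\mathsf R}_k(X,\gamma)\ \le\ \frac1{\sqrt k}\sup_{x\in X}\|\mathrm{res}(x,\gamma)\|_2.$$ Moreover, if $X$ is a body (has nonempty interior), there exists $\lambda^*\in\mathbb{R}^n_+$ with positive entries (possibly depending on $k$) such that the diagonally scaled gradient method with scaling $\lambda^*$ achieves this rate: its average regret over $k$ rounds, relative to $X$, is at most $\frac1{\sqrt k}\sup_{x\in X}\|\mathrm{res}(x,\gamma)\|_2$ for every sequence of losses $F(\cdot,s_1),\dots,F(\cdot,s_k)$ with $F\in\mathcal{F}^{\gamma,1}$.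
   Context: A set $C\subset\mathbb{R}^n$ is orthosymmetric if $x\in C$ and $\sigma\in\{\pm1\}^n$ imply $(\sigma_jx_j)_j\in C$; it is quadratically convex if $\{(x_j^2)_j: x\in C\}$ is convex. $\mathrm{res}(x,\gamma)=(x_j/\gamma(e_j))_{j=1}^n$ with $e_j$ the standard basis vectors. For a measurable sample space $\mathcal{S}$, $\mathcal{F}^{\gamma,1}$ denotes the functions $F:\mathbb{R}^n\times\mathcal{S}\to\mathbb{R}$, convex in the first argument and measurable in the second, such that $\gamma(g)\le1$ for all $x\in\mathbb{R}^n$, $s\in\mathcal{S}$, $g\in\partial_xF(x,s)$. For a distribution $P$ on $\mathcal{S}$ with $F(x,\cdot)$ $P$-integrable for all $x$, $f_P(x)=\int F(x,s)\,dP(s)$. The minimax stochastic risk is $$\mathfrak{M}^{\mathsf S}_k(X,\gamma)=\sup_{\mathcal{S}}\inf_{\hat x_k}\sup_{F\in\mathcal{F}^{\gamma,1}}\sup_{P}\ \mathbb{E}\Big[f_P(\hat x_k)-\inf_{x\in X}f_P(x)\Big],$$ where $\hat x_k$ is any $\mathbb{R}^n$-valued rule based on the observed functions $F(\cdot,S_1),\dots,F(\cdot,S_k)$, $S_i$ i.i.d. from $P$ (measurable in the samples for each $F$). The average minimax regret is $$\mathfrak{M}^{\mathsf R}_k(X,\gamma)=\sup_{\mathcal{S}}\inf_{\hat x_{1:k}}\sup_{F\in\mathcal{F}^{\gamma,1},\,s_1^k\in\mathcal{S}^k}\sup_{x\in X}\frac1k\sum_{i=1}^k\big[F(\hat x_i,s_i)-F(x,s_i)\big],$$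 where $\hat x_i\in\mathbb{R}^n$ is chosen as a function of $F(\cdot,s_1),\dots,F(\cdot,s_{i-1})$ (measurable in the samples for each $F$). Estimates and plays may lie outside $X$. The diagonally scaled gradient method with scaling $\lambda\succ0$ is online mirror descent with $h(x)=\frac12x^\top\mathrm{diag}(\lambda)x$ started at $0$: $x_1=0$, $x_{i+1}=x_i-\mathrm{diag}(\lambda)^{-1}g_i$ with $g_i\in\partial_xF(x_i,s_i)$. Its average regret relative to $X$ is $\sup_{x\in X}\frac1k\sum_{i\le k}[F(x_i,s_i)-F(x,s_i)]$. *)

(* Defs.v *)
From HB Require Import structures.
From mathcomp Require Import all_boot all_order all_algebra.
From mathcomp Require Import all_classical all_reals all_analysis.
Import Order.TTheory GRing.Theory Num.Theory.
Import numFieldNormedType.Exports.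

Set Implicit Arguments.
Unset Strict Implicit.
Unset Printing Implicit Defensive.

Local Open Scope classical_set_scope.
Local Open Scope ring_scope.

Definition hadamard (R : realType) (n : nat) (a b : 'rV[R]_n) : 'rV[R]_n :=
  \row_j (a 0 j * b 0 j).

Definition dotprod (R : realType) (n : nat) (a b : 'rV[R]_n) : R :=
  \sum_j a 0 j * b 0 j.

Definition orthosymmetric (R : realType) (n : nat) (C : set 'rV[R]_n) : Prop :=
  forall x sigma : 'rV[R]_n, C x ->
    (forall j, sigma 0 j = 1 \/ sigma 0 j = -1) -> C (hadamard sigma x).

Definition quadratically_convex (R : realType) (n : nat)
    (C : set 'rV[R]_n) : Prop :=
  convex_set [set hadamard x x | x in C].

Definition lr_norm (R : realType) (n : nat) (r : R) (x : 'rV[R]_n) : R :=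
  (\sum_j `|x 0 j| `^ r) `^ r^-1.

Definition res (R : realType) (n : nat) (x : 'rV[R]_n) (gamma : 'rV[R]_n -> R)
    : 'rV[R]_n :=
  \row_j (x 0 j / gamma (delta_mx 0 j)).

Definition subdifferential (R : realType) (n : nat) (f : 'rV[R]_n -> R)
    (x : 'rV[R]_n) : set 'rV[R]_n :=
  [set g | forall y, f x + dotprod g (y - x) <= f y].

(* The class F^{gamma,1} over the sample space T. *)
Definition loss_class (R : realType) (n : nat) (gamma : 'rV[R]_n -> R)
    (d : measure_display) (T : measurableType d) : set ('rV[R]_n -> T -> R) :=
  [set F | [/\ forall s, convex_function [set: 'rV[R]_n] (F ^~ s),
               forall x, measurable_fun [set: T] (F x)
             & forall x s g, subdifferential (F ^~ s) x g -> gamma g <= 1]].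
Arguments loss_class {R n} gamma {d} T.

(* Borel measurability of a map into R^n, coordinate by coordinate. *)
Definition measurable_rV (R : realType) (n : nat) (d : measure_display)
    (T : measurableType d) (f : T -> 'rV[R]_n) : Prop :=
  forall j, measurable_fun [set: T] (fun s => f s 0 j).

Section iid_law.
Context (R : realType) (d : measure_display) (T : measurableType d).

Section product_probability.
Context (d1 d2 : measure_display) (T1 : measurableType d1)
  (T2 : measurableType d2) (P1 : probability T1 R) (P2 : probability T2 R).

Definition product_probability : set (T1 * T2) -> \bar R := (P1 \x P2)%E.

HB.instance Definition _ := Measure.on product_probability.

Let product_probability_setT : product_probability [set: T1 * T2] = 1%E.
Proof.
rewrite /product_probability -setXTT product_measure1E//.
by rewrite [X in (X * _)%E]probability_setT mul1e; exact: probability_setT.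
Qed.

HB.instance Definition _ := Measure_isProbability.Build _ _ _
  product_probability product_probability_setT.

End product_probability.

Definition pair_cons (k : nat) (p : T * k.-tuple T) : k.+1.-tuple T :=
  [tuple of p.1 :: p.2].

Lemma measurable_pair_cons (k : nat) :
  measurable_fun [set: T * k.-tuple T] (@pair_cons k).
Proof. exact: measurable_cons. Qed.

HB.instance Definition _ (k : nat) :=
  isMeasurableFun.Build _ _ _ _ (@pair_cons k) (@measurable_pair_cons k).

(* The law P^k of (S_1, ..., S_k) when the S_i are i.i.d. from P. *)
Fixpoint iid_law (P : probability T R) (k : nat) : probability (k.-tuple T) R :=
  match k with
  | 0 => dirac [tuple]
  | k'.+1 => distribution (product_probability P (iid_law P k')) (@pair_cons k')
  end.

Lemma iid_lawE (P : probability T R) (k : nat) (A : 'I_k -> set T) :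
  (forall i, measurable (A i)) ->
  iid_law P k [set s | forall i, A i (tnth s i)] = (\prod_i P (A i))%E.
Proof.
elim: k A => [|k IH] A mA.
  by rewrite big_ord0 /= diracE mem_set// => -[].
rewrite big_ord_recl -IH//= /distribution /pushforward.
rewrite -product_measure1E//; last first.
  rewrite (_ : [set s | _] = \bigcap_(i in setT)
      ((fun s : k.-tuple T => tnth s i) @^-1` A (lift ord0 i))).
    apply: fin_bigcap_measurable => // i _.
    by rewrite -[X in measurable X]setTI; exact: measurable_tnth.
  by apply/seteqP; split=> s /= H i; have := H i; rewrite /=; try exact.
congr product_probability; apply/seteqP; split=> -[t s] /=.
  move=> H; split; first by have := H ord0.
  by move=> i; have := H (lift ord0 i); rewrite tnthS.
by move=> [H0 H] i; case: (unliftP ord0 i) => [j|] ->//; rewrite tnthS.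
Qed.

End iid_law.

Definition expected_loss (R : realType) (n : nat) (d : measure_display)
    (T : measurableType d) (F : 'rV[R]_n -> T -> R) (P : probability T R)
    (x : 'rV[R]_n) : \bar R :=
  \int[P]_s (F x s)%:E.

(* The functions F(., s_1), ..., F(., s_m) revealed by the samples s. *)
Definition observed (R : realType) (n : nat) (T : Type)
    (F : 'rV[R]_n -> T -> R) (s : seq T) : seq ('rV[R]_n -> R) :=
  [seq (fun x => F x t) | t <- s].

(* A rule is a function of the list of observed losses only: it may depend on
   the sample space T but not on F, on P or on the samples themselves. *)
Definition stochastic_rule (R : realType) (n : nat) (gamma : 'rV[R]_n -> R)
    (k : nat) (d : measure_display) (T : measurableType d)
    (xhat : seq ('rV[R]_n -> R) -> 'rV[R]_n) : Prop :=
  forall F, loss_class gamma T F ->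
    measurable_rV (fun s : k.-tuple T => xhat (observed F s)).

(* E [f_P(xhat) - inf_X f_P], in the extended reals since nothing bounds the
   values of xhat. *)
Definition excess_risk (R : realType) (n : nat) (X : set 'rV[R]_n) (k : nat)
    (d : measure_display) (T : measurableType d) (F : 'rV[R]_n -> T -> R)
    (P : probability T R) (xhat : seq ('rV[R]_n -> R) -> 'rV[R]_n) : \bar R :=
  (\int[iid_law P k]_s (expected_loss F P (xhat (observed F s))
                        - ereal_inf [set expected_loss F P x | x in X]))%E.

Definition minimax_stochastic_risk (R : realType) (n : nat) (k : nat)
    (X : set 'rV[R]_n) (gamma : 'rV[R]_n -> R) : \bar R :=
  ereal_sup [set v | exists (d : measure_display) (T : measurableType d),
    v = ereal_inf [set w | exists2 xhat, stochastic_rule gamma k T xhat &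
      w = ereal_sup [set e | exists F (P : probability T R),
        [/\ loss_class gamma T F,
            forall x, P.-integrable [set: T] (EFin \o F x)
          & e = excess_risk X k F P xhat]]]].

Definition average_regret (R : realType) (n : nat) (X : set 'rV[R]_n) (k : nat)
    (T : Type) (F : 'rV[R]_n -> T -> R) (s : k.-tuple T)
    (p : 'I_k -> 'rV[R]_n) : \bar R :=
  ereal_sup [set (k%:R^-1 *
    \sum_(i < k) (F (p i) (tnth s i) - F x (tnth s i)))%:E | x in X].

(* A strategy bundles all the plays: with rounds numbered from 0, the play at
   round i is the value of xhat on the list of the i losses seen so far. *)
Definition online_strategy (R : realType) (n : nat) (gamma : 'rV[R]_n -> R)
    (k : nat) (d : measure_display) (T : measurableType d)
    (xhat : seq ('rV[R]_n -> R) -> 'rV[R]_n) : Prop :=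
  forall i : 'I_k, stochastic_rule gamma i T xhat.

Definition minimax_regret (R : realType) (n : nat) (k : nat)
    (X : set 'rV[R]_n) (gamma : 'rV[R]_n -> R) : \bar R :=
  ereal_sup [set v | exists (d : measure_display) (T : measurableType d),
    v = ereal_inf [set w | exists2 xhat, online_strategy gamma k T xhat &
      w = ereal_sup [set e | exists F (s : k.-tuple T),
        loss_class gamma T F /\
        e = average_regret X F s
              (fun i : 'I_k => xhat (observed F (take i s)))]]].

(* The subgradient chosen at each round is arbitrary, so several sequences p
   may be runs of the method on the same losses. *)
Definition scaled_gradient_run (R : realType) (n : nat) (lambda : 'rV[R]_n)
    (k : nat) (T : Type) (F : 'rV[R]_n -> T -> R) (s : k.-tuple T)
    (p : nat -> 'rV[R]_n) : Prop :=
  p 0%N = 0 /\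
  forall i : 'I_k, exists2 g, subdifferential (F ^~ (tnth s i)) (p i) g &
    p i.+1 = p i - g *m invmx (diag_mx lambda).

(* Main.v *)
Require Import Defs.
From HB Require Import structures.
From mathcomp Require Import all_boot all_order all_algebra.
From mathcomp Require Import all_classical all_reals all_analysis.
From mathcomp Require Import measurable_realfun ring lra.
Import Order.TTheory GRing.Theory Num.Theory.
Import numFieldNormedType.Exports.

(** Write [S] for the supremum over [X] of the norm of [(x_j / beta_j)_j]; since
[gamma e_j = beta_j], this is the supremum in the statement.

Upper bound. As [r <= 2], a subgradient [g] with [gamma g <= 1] satisfies
[\sum_j (beta_j g_j)^2 <= 1]. The usual potential argument bounds the linearized
regret of the gradient method with scaling [lambda] by
[\sum_j lambda_j x_j^2 / 2 + \sum_i \sum_j g_ij^2 / (2 lambda_j)]. For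
[lambda_j = alpha / beta_j^2] the two terms are at most [alpha S^2 / 2] and
[k / (2 alpha)], and [alpha = sqrt k / S] gives [S sqrt k]
([scaled_gradient_average_regret]). When [S = 0] the origin is the only point of
[X] and playing it costs nothing. To be a legitimate strategy the method needs
subgradients that are measurable in the samples. Differentiating a convex function
at a point and then its directional derivative along each basis vector in turn
yields a linear function ([subgradientP]) through limits only
([measurable_subgradient]).

Risk is at most regret. A stochastic rule averages the plays of an online strategy.
Each play depends on earlier samples only, so the conditional mean of the loss it
suffers is its expected loss. The plays are unbounded, hence these losses need not
be integrable over all samples; [integral_compensator_le] derives the inequality
between means from the pointwise bound on the regret by integrating the samples one
at a time.

Lower bound. Fix [x] in [X]. The samples are pairs of a coordinate [j], drawn with
probability [p_j], and a sign with a small bias towards a hidden sign [v_j]; the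
loss is the distance from [y_j] to that sign times [`|x_j|], divided by [beta_j].
The minimizer of the expected loss is [x] up to signs, thus in [X]. With bias of
order [1 / sqrt (k p_j)] the hidden signs cannot be recovered from [k] samples
([assouad]), and each missed one costs about [sqrt (p_j / k) `|x_j| / beta_j]
([coin_lower_bound]). Taking [p_j] proportional to [(x_j / beta_j)^2], averaged with
the uniform law so that [k p_j >= 1] when [k >= 2 n], gives the norm of
[(x_j / beta_j)_j] over [sqrt k] up to a constant ([minimax_stochastic_risk_ge]). *)

Set Implicit Arguments.
Unset Strict Implicit.
Unset Printing Implicit Defensive.

Local Open Scope classical_set_scope.
Local Open Scope ring_scope.

(** * Directional derivatives of convex functions *)

Section convexity.
Context (R : realType) (V : lmodType R).
Implicit Types (f : V -> R) (x y h e : V).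

Lemma convex_functionP f : convex_function [set: V] f <->
  forall x y t, 0 <= t <= 1 ->
    f (t *: x + (1 - t) *: y) <= t * f x + (1 - t) * f y.
Proof.
split=> [cf x y t t01|cf t x y _ _]; last first.
  by apply: cf; rewrite ge0 le1.
have [t0 t1] := andP t01.
have /(_ (Itv01 t0 t1) x y) := cf; rewrite !inE => /(_ I I).
by rewrite convRE.
Qed.

(** Jensen's inequality, in the form that moves away from a base point: the
missing weight [1 - \sum_i w i] is put on [x]. *)
Lemma convex_jensen f (cf : convex_function [set: V] f) (I : Type) (s : seq I)
    (w : I -> R) (v : I -> V) x :
  (forall i, 0 <= w i) -> \sum_(i <- s) w i <= 1 ->
  f (x + \sum_(i <- s) w i *: v i) - f x <=
  \sum_(i <- s) w i * (f (x + v i) - f x).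
Proof.
move/convex_functionP : cf => cf.
elim: s w => [|i s IH] w w0; first by rewrite !big_nil addr0 subrr.
rewrite !big_cons => w1.
have ws0 : 0 <= \sum_(j <- s) w j by apply: sumr_ge0.
have [wi1|wi1] := eqVneq (w i) 1.
  have ws : \sum_(j <- s) w j = 0 by apply/eqP; rewrite eq_le ws0 andbT; lra.
  have wz (W : lmodType R) (u : I -> W) : \sum_(j <- s) w j *: u j = 0.
    elim: s ws {IH w1 ws0} => [|j s IH]; first by rewrite !big_nil.
    rewrite !big_cons => /eqP; rewrite paddr_eq0// ?sumr_ge0//.
    by case/andP => /eqP -> /eqP/IH ->; rewrite scale0r addr0.
  rewrite wz [X in _ <= _ + X](wz R^o (fun j => f (x + v j) - f x)).
  by rewrite wi1 scale1r mul1r !addr0.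
have wi : 0 < 1 - w i by rewrite subr_gt0 lt_neqAle wi1; lra.
have := IH (fun j => w j / (1 - w i)); rewrite -mulr_suml.
move=> /(_ (fun j => divr_ge0 (w0 j) (ltW wi))).
rewrite ler_pdivrMr// mul1r => /(_ ltac:(lra)).
set S := \sum_(j <- s) _ *: _.
set Q := \sum_(j <- s) (w j / _) * _.
move=> IHs.
have -> : \sum_(j <- s) w j *: v j = (1 - w i) *: S.
  rewrite scaler_sumr; apply: eq_bigr => j _.
  by rewrite scalerA mulrC divfK// gt_eqF.
have -> : \sum_(j <- s) w j * (f (x + v j) - f x) = (1 - w i) * Q.
  rewrite mulr_sumr; apply: eq_bigr => j _.
  by rewrite mulrA [_ * (_ / _)]mulrC divfK// gt_eqF.
have := cf (x + v i) (x + S) (w i); rewrite w0 -subr_ge0 (ltW wi) => /(_ isT).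
have -> : w i *: (x + v i) + (1 - w i) *: (x + S) =
          x + (w i *: v i + (1 - w i) *: S).
  by rewrite !scalerDr addrACA -scalerDl addrC [w i + _]addrC subrK scale1r addrC.
have : (1 - w i) * (f (x + S) - f x) <= (1 - w i) * Q by rewrite ler_wpM2l// ltW.
lra.
Qed.

Definition diffquo f x h (t : R) : R := (f (x + t *: h) - f x) / t.

(** This is the one-sided derivative of [f] at [x] along [h] when [f] is convex,
because the difference quotients then decrease with the step. *)
Definition dirder f x h : R := inf [set diffquo f x h t | t in [set t | 0 < t]].

Lemma diffquo_homo f (cf : convex_function [set: V] f) x h s t :
  0 < s -> s <= t -> diffquo f x h s <= diffquo f x h t.
Proof.
move=> s0 st; have t0 : 0 < t by exact: lt_le_trans st.
rewrite /diffquo ler_pdivrMr//.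
move/convex_functionP : cf => /(_ (x + t *: h) x (s / t)).
rewrite divr_ge0 ?(ltW s0) ?(ltW t0)//= ler_pdivrMr// mul1r => /(_ st).
rewrite scalerDr addrAC -scalerDl [_ / _ + _]addrC subrK scale1r scalerA.
rewrite divfK ?gt_eqF// => H.
have -> : (f (x + t *: h) - f x) / t * s = s / t * (f (x + t *: h) - f x).
  by field; rewrite gt_eqF.
lra.
Qed.

(** Since [x] lies midway between [x + s h] and [x - s h], the slope along [h]
is at least the opposite of the slope along [- h], and for [s <= 1] the latter is
at most its value at step 1. *)
Lemma diffquo_ge f (cf : convex_function [set: V] f) x h t : 0 < t ->
  - (f (x - h) - f x) <= diffquo f x h t.
Proof.
move=> t0.
have h0 : forall s, 0 < s -> s <= 1 -> - diffquo f x (- h) s <= diffquo f x h s.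
  move=> s s0 s1; rewrite /diffquo -mulNr ler_pM2r ?invr_gt0//.
  move/convex_functionP : cf => /(_ (x + s *: h) (x + s *: - h) 2^-1).
  have -> : 2^-1 *: (x + s *: h) + (1 - 2^-1) *: (x + s *: - h) = x.
    have -> : 1 - 2^-1 = 2^-1 :> R by field.
    rewrite -scalerDr addrACA scalerN subrr addr0 scalerDr -scalerDl.
    by rewrite (_ : 2^-1 + 2^-1 = 1) ?scale1r//; field.
  move=> /(_ ltac:(lra)); lra.
pose s := Num.min t 1.
have s0 : 0 < s by rewrite lt_min t0 ltr01.
apply: (@le_trans _ _ (diffquo f x h s)); last first.
  by apply: diffquo_homo => //; rewrite ge_min lexx.
have s1 : s <= 1 by rewrite ge_min lexx orbT.
apply: le_trans (h0 _ s0 s1); rewrite lerN2.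
apply: (le_trans (diffquo_homo cf _ _ s0 s1)).
by rewrite /diffquo scale1r divr1.
Qed.

Lemma has_inf_diffquo f (cf : convex_function [set: V] f) x h :
  has_inf [set diffquo f x h t | t in [set t | 0 < t]].
Proof.
split; first by exists (diffquo f x h 1); exists 1 => //=.
by exists (- (f (x - h) - f x)) => _ [t /= t0 <-]; exact: diffquo_ge.
Qed.

Lemma dirder_le f (cf : convex_function [set: V] f) x h t :
  0 < t -> dirder f x h <= diffquo f x h t.
Proof.
by move=> t0; apply: ge_inf; [have [] := has_inf_diffquo cf x h | exists t].
Qed.

Lemma dirder_le1 f (cf : convex_function [set: V] f) x h :
  dirder f x h <= f (x + h) - f x.
Proof.
by apply: (le_trans (dirder_le cf x h ltr01)); rewrite /diffquo scale1r divr1.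
Qed.

Lemma dirder_ge f (cf : convex_function [set: V] f) x h b :
  (forall t, 0 < t -> b <= diffquo f x h t) -> b <= dirder f x h.
Proof.
move=> H; apply: lb_le_inf; first by have [] := has_inf_diffquo cf x h.
by move=> _ [t /= t0 <-]; exact: H.
Qed.

(** One sequence of steps suffices to approach the infimum, which makes [dirder]
measurable in parameters. *)
Lemma dirder_cvg f (cf : convex_function [set: V] f) x h :
  diffquo f x h m.+1%:R^-1 @[m --> \oo] --> dirder f x h.
Proof.
have m0 (m : nat) : 0 < m.+1%:R^-1 :> R by rewrite invr_gt0.
have -> : dirder f x h = inf (range (fun m => diffquo f x h m.+1%:R^-1)).
  apply/eqP; rewrite eq_le; apply/andP; split.
    apply: lb_le_inf; first by exists (diffquo f x h 1%:R^-1); exists 0%N.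
    by move=> _ [m _ <-]; exact: dirder_le.
  apply: dirder_ge => // t t0.
  have [m mt] : exists m, m.+1%:R^-1 <= t :> R.
    exists (Num.trunc t^-1); rewrite -[leRHS]invrK lef_pV2 ?posrE ?invr_gt0//.
    by rewrite ltW// truncnS_gt.
  apply: le_trans (diffquo_homo cf _ _ (m0 m) mt).
  apply: ge_inf; last by exists m.
  by exists (- (f (x - h) - f x)) => _ [k _ <-]; exact: diffquo_ge.
apply: nonincreasing_cvgn.
  move=> m k mk; apply: diffquo_homo => //.
  by rewrite lef_pV2 ?posrE// ler_nat.
by exists (- (f (x - h) - f x)) => _ [k _ <-]; exact: diffquo_ge.
Qed.

Definition sublinear (f : V -> R) : Prop :=
  (forall t h, 0 < t -> f (t *: h) = t * f h) /\
  (forall h e, f (h + e) <= f h + f e).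

Lemma dirder_sublinear f (cf : convex_function [set: V] f) x :
  sublinear (dirder f x).
Proof.
have homle t h : 0 < t -> t * dirder f x h <= dirder f x (t *: h).
  move=> t0; apply: dirder_ge => // s s0.
  have -> : diffquo f x (t *: h) s = t * diffquo f x h (s * t).
    rewrite /diffquo scalerA invfM mulrCA; congr (_ * _).
    by rewrite mulrCA mulfV ?mulr1// gt_eqF.
  by rewrite ler_pM2l// dirder_le// mulr_gt0.
split=> [t h t0|h e].
  apply/eqP; rewrite eq_le homle// andbT.
  rewrite -ler_pdivrMl//; apply: le_trans (homle _ _ _) _.
    by rewrite invr_gt0.
  by rewrite scalerA mulVf ?gt_eqF// scale1r.
rewrite -lerBlDr; apply: dirder_ge => // t t0.
rewrite lerBlDr -lerBlDl; apply: dirder_ge => // t' t'0; rewrite lerBlDl.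
pose s := Num.min t t' / 2.
have s0 : 0 < s by rewrite divr_gt0// lt_min t0.
have s20 : 0 < 2 * s by rewrite mulr_gt0.
apply: (le_trans (dirder_le cf x _ s0)).
have E : 2 * s = Num.min t t' by rewrite /s mulrC divfK.
have H1 : diffquo f x h (2 * s) <= diffquo f x h t.
  by apply: diffquo_homo; rewrite // E ge_min lexx.
have H2 : diffquo f x e (2 * s) <= diffquo f x e t'.
  by apply: diffquo_homo; rewrite // E ge_min lexx orbT.
apply: le_trans (lerD H1 H2) => {H1 H2}.
rewrite /diffquo -mulrDl ler_pdivlMr// mulrAC ler_pdivrMr//.
move/convex_functionP : cf => /(_ (x + (2 * s) *: h) (x + (2 * s) *: e) 2^-1).
have h2 : 1 - 2^-1 = 2^-1 :> R by field.
have -> : 2^-1 *: (x + (2 * s) *: h) + (1 - 2^-1) *: (x + (2 * s) *: e) =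
          x + s *: (h + e).
  rewrite h2 !scalerDr !scalerA mulKf ?pnatr_eq0// addrACA -scalerDl.
  by rewrite (_ : 2^-1 + 2^-1 = 1) ?scale1r//; field.
move=> /(_ ltac:(lra)); rewrite h2 => H.
rewrite mulrCA mulrA ler_pM2r//; lra.
Qed.

Lemma sublinear_convex f : sublinear f -> convex_function [set: V] f.
Proof.
move=> [fZ fD]; apply/convex_functionP => x y t /andP[t0 t1].
have f0 : f 0 = 0 by have := fZ 2 0 ltac:(lra); rewrite scaler0; lra.
apply: le_trans (fD _ _) _; apply: lerD.
  by move: t0; rewrite le_eqVlt => /predU1P[<-|/fZ->//]; rewrite scale0r mul0r f0.
have : 0 <= 1 - t by rewrite subr_ge0.
by rewrite le_eqVlt => /predU1P[<-|/fZ->//]; rewrite scale0r mul0r f0.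
Qed.

Lemma sublinear_opp f h : sublinear f -> - f (- h) <= f h.
Proof.
move=> [fZ fD]; have f0 : f 0 = 0 by have := fZ 2 0 ltac:(lra); rewrite scaler0; lra.
by have := fD h (- h); rewrite subrr f0; lra.
Qed.

Lemma sublinear_dirder_le f e h : sublinear f -> dirder f e h <= f h.
Proof.
move=> sf; apply: (le_trans (dirder_le1 (sublinear_convex sf) _ _)).
by rewrite lerBlDl; apply sf.2.
Qed.

(** By homogeneity a sublinear function is affine along the ray through [e], in
both directions from [e]. *)
Lemma sublinear_dirder_opp f e : sublinear f ->
  dirder f e (- e) <= - f e /\ dirder f e e <= f e.
Proof.
move=> sf; split; last exact: sublinear_dirder_le.
have h0 : 0 < 2^-1 :> R by rewrite invr_gt0.
apply: (le_trans (dirder_le (sublinear_convex sf) e (- e) h0)).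
rewrite /diffquo; have -> : e + 2^-1 *: - e = 2^-1 *: e.
  rewrite scalerN -[X in X - _]scale1r -scalerBl.
  by congr (_ *: _); field.
rewrite sf.1// ler_pdivrMr//; lra.
Qed.

End convexity.

(** * Measurable subgradients *)

Section convexity_rV.
Context (R : realType) (n : nat).
Implicit Types (f : 'rV[R]_n -> R) (x h : 'rV[R]_n).

(** Near [x], a displacement [h] with [\sum_j `|h_j| <= 1] mixes the neighbours
[x + e_j] and [x - e_j] with weights [`|h_j|]: Jensen's inequality bounds [f]
from above, and the midpoint inequality turns this into a lower bound. *)
Lemma convex_locally_lipschitz f x : convex_function [set: 'rV[R]_n] f ->
  exists M, forall h, \sum_j `|h 0 j| <= 1 ->
    `|f (x + h) - f x| <= M * \sum_j `|h 0 j|.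
Proof.
move=> cf; pose e j : 'rV[R]_n := delta_mx 0 j.
pose M := \sum_j (`|f (x + e j) - f x| + `|f (x - e j) - f x|).
have up h : \sum_j `|h 0 j| <= 1 -> f (x + h) - f x <= M * \sum_j `|h 0 j|.
  move=> h1.
  have := convex_jensen cf (fun j => Num.sg (h 0 j) *: e j) x
    (fun j => normr_ge0 (h 0 j)) h1.
  have -> : \sum_j `|h 0 j| *: (Num.sg (h 0 j) *: e j) = h.
    rewrite [RHS]row_sum_delta; apply: eq_bigr => j _.
    by rewrite scalerA mulrC -numEsg.
  move=> /le_trans; apply; rewrite mulr_sumr; apply: ler_sum => j _.
  rewrite mulrC ler_wpM2r// /M (bigD1 j)//=.
  apply: (@le_trans _ _ (`|f (x + e j) - f x| + `|f (x - e j) - f x|)); last first.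
    by rewrite lerDl sumr_ge0// => i _; rewrite addr_ge0.
  case: sgrP => _.
  - by rewrite scale0r addr0 subrr addr_ge0.
  - by rewrite scale1r ler_wpDr// ler_norm.
  - by rewrite scaleN1r ler_wpDl// ler_norm.
exists M => h h1; rewrite ler_norml up// andbT.
have := up (- h); rewrite [X in X <= 1 -> _](_ : _ = \sum_j `|h 0 j|); last first.
  by apply: eq_bigr => j _; rewrite !mxE normrN.
move=> /(_ h1); rewrite [X in _ <= _ * X](_ : _ = \sum_j `|h 0 j|); last first.
  by apply: eq_bigr => j _; rewrite !mxE normrN.
move=> H; move/convex_functionP : cf => /(_ (x + h) (x - h) 2^-1).
have -> : 2^-1 *: (x + h) + (1 - 2^-1) *: (x - h) = x.
  have -> : 1 - 2^-1 = 2^-1 :> R by field.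
  rewrite -scalerDr addrACA subrr addr0 scalerDr -scalerDl.
  by rewrite (_ : 2^-1 + 2^-1 = 1) ?scale1r//; field.
move=> /(_ ltac:(lra)); lra.
Qed.

Lemma convex_continuous f : convex_function [set: 'rV[R]_n] f -> continuous f.
Proof.
move=> cf x; have [M Mf] := convex_locally_lipschitz x cf.
apply/(@cvgrPdist_le _ _ _ _ (nbhs_filter x)) => e e0.
pose N := \sum_(j < n) (1 : R).
have N0 : 0 <= N by apply: sumr_ge0.
pose d := Num.min 1 (e / (1 + `|M|)) / (1 + N).
have M0 : 0 < 1 + `|M| by rewrite ltr_pwDl.
have N1 : 0 < 1 + N by rewrite ltr_pwDl.
have d0 : 0 < d by rewrite divr_gt0// lt_min ltr01 divr_gt0.
apply/nbhs_ballP; exists d => //= y xy.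
have yd : \sum_j `|(y - x) 0 j| <= Num.min 1 (e / (1 + `|M|)).
  apply: (@le_trans _ _ (\sum_(j < n) d)).
    apply: ler_sum => j _.
    by rewrite !mxE distrC ltW//; have [_] := xy; apply.
  rewrite (_ : \sum_(j < n) d = N * d); last first.
    by rewrite mulr_suml; under [RHS]eq_bigr do rewrite mul1r.
  rewrite /d mulrCA ger_pMr ?lt_min ?ltr01 ?divr_gt0//.
  by rewrite ler_pdivrMr// mul1r lerDr.
have := Mf (y - x); rewrite [x + _]addrC subrK distrC => /(_ _)/le_trans; apply.
  by apply: (le_trans yd); rewrite ge_min lexx.
apply: (@le_trans _ _ (`|M| * (e / (1 + `|M|)))).
  apply: (@le_trans _ _ (`|M| * \sum_j `|(y - x) 0 j|)).
    by rewrite ler_wpM2r ?sumr_ge0// ler_norm.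
  by rewrite ler_wpM2l//; apply: (le_trans yd); rewrite ge_min lexx orbT.
by rewrite mulrCA ger_pMr// ler_pdivrMr// mul1r lerDr.
Qed.

(** Subgradients are selected by differentiating [f] at [x], then the resulting
sublinear function along each basis vector in turn: the outcome is linear on the
basis. Unlike an arbitrary choice, this one is a limit of difference quotients,
hence measurable in parameters. *)
Definition lexicographic (phi : 'rV[R]_n -> R) (s : seq 'I_n) : 'rV[R]_n -> R :=
  foldl (fun psi j => dirder psi (delta_mx 0 j)) phi s.

Definition subgradient f x : 'rV[R]_n :=
  \row_j lexicographic (dirder f x) (enum 'I_n) (delta_mx 0 j).

(** Differentiation lowers a sublinear function, so oddness along a basis vector,
once gained by differentiating there, is never lost. *)
Lemma lexicographicP phi s : sublinear phi ->
  [/\ sublinear (lexicographic phi s),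
      forall h, lexicographic phi s h <= phi h
    & forall j, j \in s \/ phi (- delta_mx 0 j) <= - phi (delta_mx 0 j) ->
        lexicographic phi s (- delta_mx 0 j) <=
        - lexicographic phi s (delta_mx 0 j)].
Proof.
elim: s phi => [|i s IH] phi sphi /=; first by split=> // j [].
have sphi' := dirder_sublinear (sublinear_convex sphi) (delta_mx 0 i).
have [H1 H2 H3] := IH _ sphi'; split=> // [h|j js].
  by apply: (le_trans (H2 h)); exact: sublinear_dirder_le.
apply: H3; rewrite inE in js; case: js => [/predU1P[->|]|jphi]; [right| by left|right].
  have [He Hn] := sublinear_dirder_opp (delta_mx 0 i) sphi.
  by apply: (le_trans He); rewrite lerN2.
apply: (le_trans (sublinear_dirder_le _ _ sphi)); apply: (le_trans jphi).
by rewrite lerN2; exact: sublinear_dirder_le.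
Qed.

Lemma sublinear_sum (phi : 'rV[R]_n -> R) (I : Type) (s : seq I) (v : I -> 'rV[R]_n) :
  sublinear phi -> phi (\sum_(i <- s) v i) <= \sum_(i <- s) phi (v i).
Proof.
move=> [pZ pD]; elim: s => [|i s IH]; last first.
  by rewrite !big_cons; apply: (le_trans (pD _ _)); rewrite lerD2l.
by rewrite !big_nil; have := pZ 2 0 ltac:(lra); rewrite scaler0; lra.
Qed.

(** The directional derivative lies below the increments of [f], the
lexicographic function below the directional derivative, and a sublinear
function that is odd on the basis is bounded below by its linear part. *)
Lemma subgradientP f x : convex_function [set: 'rV[R]_n] f ->
  subdifferential f x (subgradient f x).
Proof.
move=> cf y; have sd := dirder_sublinear cf x.
have [sl le1 lin] := lexicographicP (enum 'I_n) sd.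
set phi := lexicographic _ _ in sl le1 lin.
have -> : y = x + (y - x) by rewrite addrC subrK.
rewrite [x + (y - x) - x]addrC addKr; move: (y - x) => h.
rewrite -lerBrDl; apply: le_trans (dirder_le1 cf x h).
apply: le_trans (le1 h); apply: le_trans (sublinear_opp h sl).
rewrite lerNr /dotprod -sumrN.
rewrite [X in phi (- X)]row_sum_delta -sumrN.
apply: (le_trans (sublinear_sum _ _ sl)); apply: ler_sum => j _.
rewrite mxE -/phi mulrC.
have lj : phi (- delta_mx 0 j) <= - phi (delta_mx 0 j).
  by apply: lin; left; rewrite mem_enum.
have [h0|h0|->] := ltrgt0P (h 0 j).
- by rewrite -scalerN sl.1// -mulrN ler_pM2l.
- by rewrite -scaleNr sl.1 ?oppr_gt0// mulNr.
- rewrite scale0r oppr0 mul0r oppr0.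
  by have := sl.1 2 0 ltac:(lra); rewrite scaler0; lra.
Qed.

End convexity_rV.

Section measurability.
Context (R : realType) (n : nat) (d : measure_display) (T : measurableType d).
Implicit Types (f : T -> 'rV[R]_n -> R) (x : T -> 'rV[R]_n).

(** A function convex in one argument and measurable in the other is a
Caratheodory function, so that it may be composed with a measurable choice of the
first argument. Rounding that choice down to a grid of step [1 / m.+1] reduces
the claim to countably many constant choices. *)
Lemma measurable_convex_comp f x :
  (forall t, convex_function [set: 'rV[R]_n] (f t)) ->
  (forall y, measurable_fun [set: T] (f ^~ y)) -> measurable_rV x ->
  measurable_fun [set: T] (fun t => f t (x t)).
Proof.
move=> cf mf mx.
pose z (m : nat) t : 'rV[int]_n := \row_j Num.floor (x t 0 j * m.+1%:R).
pose grid (m : nat) (u : 'rV[int]_n) : 'rV[R]_n := \row_j ((u 0 j)%:~R / m.+1%:R).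
apply: (@measurable_fun_cvg _ _ _ _ (fun m t => f t (grid m (z m t)))).
  move=> m _ B mB; rewrite setTI.
  rewrite (_ : _ @^-1` _ = \bigcup_(u : 'rV[int]_n)
      ([set t | forall j, z m t 0 j = u 0 j] `&` (f ^~ (grid m u)) @^-1` B)); last first.
    apply/seteqP; split=> [t /= Bt|t [u _ /= [zu]]]; first by exists (z m t).
    by rewrite (_ : z m t = u)//; apply/rowP.
  apply: countable_bigcupT_measurable; first exact: countableP.
  move=> u; apply: measurableI; last by rewrite -[X in measurable X]setTI; exact: mf.
  rewrite (_ : [set t | _] = \bigcap_(j in [set: 'I_n])
     ((fun t => Num.floor (x t 0 j * m.+1%:R)) @^-1` [set u 0 j])).
    apply: fin_bigcap_measurable => [//|j _].
    rewrite -[X in measurable X]setTI.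
    have mfl : measurable_fun [set: T] (fun t => x t 0 j * m.+1%:R).
      by apply: measurable_funM => //; exact: mx.
    rewrite (_ : _ @^-1` _ = (fun t => x t 0 j * m.+1%:R) @^-1`
        `[(u 0 j)%:~R, (u 0 j + 1)%:~R[%classic); last first.
      apply/seteqP; split=> [t /= <-|t /=]; rewrite in_itv/=.
        by rewrite floor_itv ?num_real.
      by move=> H; apply/floor_def.
    exact: mfl.
  apply/seteqP; split=> [t H j _ /=|t H j]; first by rewrite -H mxE.
  by have := H j I; rewrite /= mxE.
move=> t _.
have /(_ (x t)) := convex_continuous (cf t).
move/(@cvgrPdist_le _ _ _ _ (nbhs_filter (x t))) => fc; apply/cvgrPdist_le => e e0.
have {fc} := fc e e0 => /nbhs_ballP[r /= r0 rB].
near=> m; apply: rB; split=> // i j; rewrite ord1 !mxE /ball/=.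
have m0 : 0 < m.+1%:R :> R by [].
have /andP[f1 f2] := floor_itv (x t 0 j * m.+1%:R).
set a := _ * _ in f1 f2.
have -> : x t 0 j - (Num.floor a)%:~R / m.+1%:R =
          (a - (Num.floor a)%:~R) / m.+1%:R.
  by rewrite mulrBl /a mulfK// gt_eqF.
rewrite normrM [X in _ * X]ger0_norm ?invr_ge0// ger0_norm ?subr_ge0//.
apply: (@le_lt_trans _ _ m.+1%:R^-1).
  rewrite -[leRHS]mul1r ler_wpM2r ?invr_ge0//.
  by move: f2; rewrite intrD mulr1z; lra.
near: m; exact: near_infty_natSinv_lt (PosNum r0).
Unshelve. all: by end_near.
Qed.

Lemma measurable_dirder f x h :
  (forall t, convex_function [set: 'rV[R]_n] (f t)) ->
  (forall y, measurable_fun [set: T] (f ^~ y)) -> measurable_rV x ->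
  measurable_fun [set: T] (fun t => dirder (f t) (x t) h).
Proof.
move=> cf mf mx.
apply: (@measurable_fun_cvg _ _ _ _
    (fun m t => diffquo (f t) (x t) h m.+1%:R^-1)); last first.
  by move=> t _; exact: dirder_cvg.
move=> m; apply: measurable_funM => //; apply: measurable_funB.
  apply: measurable_convex_comp => // j.
  under eq_fun do rewrite mxE.
  by apply: measurable_funD => //; exact: mx.
exact: measurable_convex_comp.
Qed.

Lemma measurable_subgradient f x :
  (forall t, convex_function [set: 'rV[R]_n] (f t)) ->
  (forall y, measurable_fun [set: T] (f ^~ y)) -> measurable_rV x ->
  measurable_rV (fun t => subgradient (f t) (x t)).
Proof.
move=> cf mf mx j; under eq_fun do rewrite mxE.
have lexm (s : seq 'I_n) (phi : T -> 'rV[R]_n -> R) :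
    (forall t, sublinear (phi t)) ->
    (forall h, measurable_fun [set: T] (phi ^~ h)) ->
    forall h, measurable_fun [set: T] (fun t => lexicographic (phi t) s h).
  elim: s phi => [//|i s IH] phi sphi mphi.
  apply: (IH (fun t => dirder (phi t) (delta_mx 0 i))) => [t|h].
    by apply: dirder_sublinear; exact: sublinear_convex.
  by apply: measurable_dirder => // t; exact: sublinear_convex.
apply: (lexm _ (fun t => dirder (f t) (x t))) => [t|h].
  exact: dirder_sublinear.
exact: measurable_dirder.
Qed.

End measurability.

(** * Regret of the scaled gradient method *)

Section weighted_norms.
Context (R : realType) (n : nat).
Implicit Types (r : R) (x y : 'rV[R]_n).

Lemma lr_norm_delta r (c : R) j : 0 < r ->
  lr_norm r (c *: delta_mx 0 j : 'rV[R]_n) = `|c|.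
Proof.
move=> r0; rewrite /lr_norm (bigD1 j)//= big1 => [|i ij]; last first.
  by rewrite !mxE (negPf ij) andbF mulr0 normr0 powR0// gt_eqF.
rewrite !mxE !eqxx mulr1 addr0 -powRrM mulfV ?gt_eqF// powRr1//.
Qed.

Lemma lr_norm2 x : lr_norm 2 x = Num.sqrt (\sum_j x 0 j ^+ 2).
Proof.
rewrite /lr_norm powR12_sqrt; last by apply: sumr_ge0 => j _; exact: powR_ge0.
by congr Num.sqrt; apply: eq_bigr => j _; rewrite powR_mulrn// real_normK ?num_real.
Qed.

(** Entries of a vector in the unit ball are at most 1 in absolute value, so
squaring them decreases them at least as much as the exponent [r <= 2]. *)
Lemma lr_norm_le1 r y : 1 <= r <= 2 -> lr_norm r y <= 1 ->
  \sum_j y 0 j ^+ 2 <= 1.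
Proof.
move=> /andP[r1 r2] y1; have r0 : 0 < r by exact: lt_le_trans r1.
have s1 : \sum_j `|y 0 j| `^ r <= 1.
  rewrite leNgt; apply/negP => s1; move: y1; apply/negP; rewrite -ltNge.
  rewrite /lr_norm; set s := (X in X `^ _) in s1 *.
  have s0 : 0 < s by exact: lt_trans s1.
  have := @gt0_ltr_powR R r^-1; rewrite invr_gt0 => /(_ r0 1 s).
  by rewrite powR1 !nnegrE ler01 ltW// => /(_ isT isT s1).
apply: (le_trans _ s1); apply: ler_sum => j _.
have yj1 : `|y 0 j| <= 1.
  rewrite leNgt; apply/negP => yj; have := le1r_powR (ltW yj) r1.
  apply/negP; rewrite -ltNge; apply: le_lt_trans yj; apply: le_trans s1.
  by rewrite [leRHS](bigD1 j)//= lerDl sumr_ge0// => i _; exact: powR_ge0.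
rewrite -real_normK ?num_real// -powR_mulrn//.
have [->|y0] := eqVneq `|y 0 j| 0.
  by rewrite !powR0// ?gt_eqF// pnatr_eq0.
by apply: ger_powR => //; rewrite lt_neqAle eq_sym y0 normr_ge0.
Qed.

End weighted_norms.

Section scaled_gradient.
Context (R : realType) (n : nat).
Implicit Types (lambda beta g x : 'rV[R]_n).

Lemma mulmx_invmx_diag g lambda : (forall j, 0 < lambda 0 j) ->
  g *m invmx (diag_mx lambda) = \row_j (g 0 j / lambda 0 j).
Proof.
move=> l0; have l1 : diag_mx (\row_j (lambda 0 j)^-1) *m diag_mx lambda = 1%:M.
  rewrite mulmx_diag -diag_const_mx; congr diag_mx; apply/rowP => j.
  by rewrite !mxE mulVf// gt_eqF.
have [_ lu] := mulmx1_unit l1.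
have -> : invmx (diag_mx lambda) = diag_mx (\row_j (lambda 0 j)^-1).
  by rewrite -[LHS]mul1mx -l1 mulmxK.
by rewrite mul_mx_diag; apply/rowP => j; rewrite !mxE.
Qed.

(** The potential [\sum_j lambda_j (p_i - x)_j^2 / 2] pays for the linearized
regret, up to the squared dual norms of the gradients. *)
Lemma scaled_gradient_linear_regret lambda (k : nat) (p g : nat -> 'rV[R]_n) x :
  (forall j, 0 < lambda 0 j) -> p 0%N = 0 ->
  (forall i, (i < k)%N -> p i.+1 = p i - g i *m invmx (diag_mx lambda)) ->
  \sum_(i < k) dotprod (g i) (p i - x) <=
    (\sum_j lambda 0 j * x 0 j ^+ 2) / 2 +
    (\sum_(i < k) \sum_j g i 0 j ^+ 2 / lambda 0 j) / 2.
Proof.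
move=> l0 p0 pS; pose Phi i := (\sum_j lambda 0 j * (p i 0 j - x 0 j) ^+ 2) / 2.
suff H : \sum_(i < k) dotprod (g i) (p i - x) + Phi k = Phi 0%N +
    (\sum_(i < k) \sum_j g i 0 j ^+ 2 / lambda 0 j) / 2.
  have : 0 <= Phi k.
    by rewrite divr_ge0// sumr_ge0// => j _; rewrite mulr_ge0 ?sqr_ge0// ltW.
  have -> : \sum_j lambda 0 j * x 0 j ^+ 2 =
            \sum_j lambda 0 j * (p 0%N 0 j - x 0 j) ^+ 2.
    by apply: eq_bigr => j _; rewrite p0 mxE sub0r sqrrN.
  rewrite /Phi in H *; lra.
elim: k pS => [|k IH] pS; first by rewrite !big_ord0 mul0r add0r addr0.
rewrite !big_ord_recr/=.
have {}IH := IH (fun i ik => pS i (ltnW ik)).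
have S : dotprod (g k) (p k - x) + Phi k.+1 =
         Phi k + (\sum_j g k 0 j ^+ 2 / lambda 0 j) / 2.
  rewrite /Phi /dotprod -[X in X + _](mulfK (_ : 2 != 0))// -!mulrDl; congr (_ / _).
  rewrite mulr_suml -!big_split/=; apply: eq_bigr => j _.
  by rewrite pS// mulmx_invmx_diag// !mxE; field; rewrite gt_eqF.
by rewrite -addrA S addrA IH -addrA -mulrDl.
Qed.

(** With [lambda_j] proportional to [beta_j^-2] both halves of the previous
bound depend on [x] and on the gradients through weighted Euclidean norms only;
the factor balances the two halves. *)
Lemma scaled_gradient_average_regret beta (S : R) (k : nat) (X : set 'rV[R]_n)
    (gamma : 'rV[R]_n -> R) (d : measure_display) (T : measurableType d)
    (F : 'rV[R]_n -> T -> R) (s : k.-tuple T) (p : nat -> 'rV[R]_n) :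
  (0 < k)%N -> 0 < S -> (forall j, 0 < beta 0 j) ->
  (forall g, gamma g <= 1 -> \sum_j (beta 0 j * g 0 j) ^+ 2 <= 1) ->
  (forall x, X x -> \sum_j (x 0 j / beta 0 j) ^+ 2 <= S ^+ 2) ->
  loss_class gamma T F ->
  scaled_gradient_run (\row_j (Num.sqrt k%:R / S / beta 0 j ^+ 2)) F s p ->
  (average_regret X F s (fun i : 'I_k => p i) <= ((Num.sqrt k%:R)^-1 * S)%:E)%E.
Proof.
move=> k0 S0 b0 gb XS [_ _ gF] [p0 /= pS]; set lambda := \row_j _ in pS.
have kR : 0 < k%:R :> R by rewrite ltr0n.
have sk : 0 < Num.sqrt k%:R :> R by rewrite sqrtr_gt0.
have sk2 : Num.sqrt k%:R * Num.sqrt k%:R = k%:R :> R.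
  by rewrite -expr2 sqr_sqrtr// ltW.
have l0 j : 0 < lambda 0 j by rewrite mxE !divr_gt0// exprn_gt0.
have [g gP] : {g : nat -> 'rV[R]_n | forall i : 'I_k,
    subdifferential (F ^~ (tnth s i)) (p i) (g i) /\
    p i.+1 = p i - g i *m invmx (diag_mx lambda)}.
  apply: cid.
  have /choice[g gP] : forall i : nat, exists g, forall ik : (i < k)%N,
      subdifferential (F ^~ (tnth s (Ordinal ik))) (p i) g /\
      p i.+1 = p i - g *m invmx (diag_mx lambda).
    move=> i; have [ik|ik] : (i < k)%N \/ (k <= i)%N by case: ltnP; [left|right].
      2: by exists 0 => ik'; move: (leq_trans ik' ik); rewrite ltnn.
    have [g sg pg] := pS (Ordinal ik).
    by exists g => ik'; have -> : ik' = ik by exact: bool_irrelevance.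
  by exists g => -[i ik]; exact: gP.
apply: ge_ereal_sup => _ [x Xx <-]; rewrite lee_fin.
have kS : k%:R * ((Num.sqrt k%:R)^-1 * S) = Num.sqrt k%:R * S.
  by rewrite -{1}sk2 -mulrA mulVKf// gt_eqF.
rewrite ler_pdivrMl// kS.
apply: (@le_trans _ _ (\sum_(i < k) dotprod (g i) (p i - x))).
  apply: ler_sum => i _; have [sg _] := gP i; have := sg x.
  have -> : dotprod (g i) (x - p i) = - dotprod (g i) (p i - x).
    by rewrite /dotprod -sumrN; apply: eq_bigr => j _; rewrite !mxE; ring.
  lra.
have pS' i : (i < k)%N -> p i.+1 = p i - g i *m invmx (diag_mx lambda).
  by move=> ik; have [] := gP (Ordinal ik).
apply: (le_trans (scaled_gradient_linear_regret _ l0 p0 pS')).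
have H1 : \sum_j lambda 0 j * x 0 j ^+ 2 <= Num.sqrt k%:R * S.
  have -> : \sum_j lambda 0 j * x 0 j ^+ 2 =
            Num.sqrt k%:R / S * \sum_j (x 0 j / beta 0 j) ^+ 2.
    rewrite mulr_sumr; apply: eq_bigr => j _; rewrite mxE; field.
    by rewrite !gt_eqF.
  have -> : Num.sqrt k%:R * S = Num.sqrt k%:R / S * S ^+ 2 by field; rewrite gt_eqF.
  by rewrite ler_wpM2l ?XS// divr_ge0// ltW.
have H2 : \sum_(i < k) \sum_j g i 0 j ^+ 2 / lambda 0 j <= Num.sqrt k%:R * S.
  apply: (@le_trans _ _ (\sum_(i < k) (S / Num.sqrt k%:R))); last first.
    rewrite sumr_const card_ord -(mulr_natl (S / _)) mulrCA mulrC ler_wpM2r ?(ltW S0)//.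
    by rewrite -{1}sk2 mulfK// gt_eqF.
  apply: ler_sum => i _; have [sg _] := gP i.
  have -> : \sum_j g i 0 j ^+ 2 / lambda 0 j =
            S / Num.sqrt k%:R * \sum_j (beta 0 j * g i 0 j) ^+ 2.
    rewrite mulr_sumr; apply: eq_bigr => j _; rewrite mxE; field.
    by rewrite !gt_eqF.
  rewrite -[leRHS]mulr1 ler_wpM2l ?divr_ge0 ?(ltW S0) ?(ltW sk)//.
  by apply: gb; apply: gF sg.
lra.
Qed.

End scaled_gradient.

Lemma take_tnthS (T : Type) (m i : nat) (s : m.-tuple T) (im : (i < m)%N) :
  take i.+1 s = rcons (take i s) (tnth s (Ordinal im)).
Proof.
have x0 := tnth s (Ordinal im).
by rewrite (tnth_nth x0)/= (take_nth x0)// size_tuple.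
Qed.

Section gradient_strategy.
Context (R : realType) (n : nat) (lambda : 'rV[R]_n).

Definition gradient_strategy (l : seq ('rV[R]_n -> R)) : 'rV[R]_n :=
  foldl (fun x f => x - subgradient f x *m invmx (diag_mx lambda)) 0 l.

Lemma gradient_strategy_rcons l f : gradient_strategy (rcons l f) =
  gradient_strategy l -
    subgradient f (gradient_strategy l) *m invmx (diag_mx lambda).
Proof. by rewrite /gradient_strategy foldl_rcons. Qed.

Lemma gradient_strategy_run gamma k d (T : measurableType d)
    (F : 'rV[R]_n -> T -> R) (s : k.-tuple T) : loss_class gamma T F ->
  scaled_gradient_run lambda F s
    (fun i => gradient_strategy (observed F (take i s))).
Proof.
move=> [cF _ _]; split=> [|[i ik]]; first by rewrite take0.
set x := gradient_strategy (observed F (take i s)).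
exists (subgradient (F ^~ (tnth s (Ordinal ik))) x); first exact: subgradientP.
by rewrite /= take_tnthS /observed map_rcons gradient_strategy_rcons.
Qed.

(** A rule sees functions rather than samples; the plays are measurable in the
samples because the subgradients are selected measurably. *)
Lemma gradient_strategy_online gamma k d (T : measurableType d) :
  online_strategy gamma k T gradient_strategy.
Proof.
move=> [m _] F [cF mF _] /=.
suff H i : (i <= m)%N -> measurable_rV
    (fun s : m.-tuple T => gradient_strategy (observed F (take i s))).
  have := H m (leqnn m).
  by under eq_fun do rewrite take_oversize ?size_tuple//.
elim: i => [_ j|i IH im].
  by under eq_fun do rewrite take0 mxE; exact: measurable_cst.
under eq_fun => s.
  rewrite take_tnthS /observed map_rcons gradient_strategy_rcons.
  over.
have {}IH := IH (ltnW im).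
have mg := @measurable_subgradient _ _ _ _
  (fun (s : m.-tuple T) x => F x (tnth s (Ordinal im))) _
  (fun s => cF _) (fun y => measurableT_comp (mF y) (measurable_tnth _)) IH.
move=> j; under eq_fun do rewrite !mxE.
apply: measurable_funB; first exact: IH.
by apply: measurable_sum => u; apply: measurable_funM => //; exact: mg.
Qed.

End gradient_strategy.

(** * Integration over independent samples *)

Section iid_integral.
Context (R : realType) (d : measure_display) (T : measurableType d).
Local Open Scope ereal_scope.

Lemma ge0_integral_iid_lawS (P : probability T R) (k : nat)
    (f : k.+1.-tuple T -> \bar R) :
  measurable_fun [set: k.+1.-tuple T] f -> (forall s, 0 <= f s) ->
  \int[iid_law P k.+1]_s f s =
  \int[P]_t \int[iid_law P k]_s f (pair_cons (t, s)).
Proof.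
move=> mf f0; rewrite /= /distribution ge0_integral_pushforward//.
rewrite preimage_setT.
have -> : \int[product_probability P (iid_law P k)]_x (f \o @pair_cons _ _ k) x =
          \int[P \x iid_law P k]_x (f \o @pair_cons _ _ k) x by [].
rewrite fubini_tonelli1//.
  exact: measurableT_comp.
by move=> x; exact: f0.
Qed.

Lemma measurable_iid_section (P : probability T R) (k : nat)
    (f : k.+1.-tuple T -> \bar R) :
  measurable_fun [set: k.+1.-tuple T] f -> (forall s, 0 <= f s) ->
  measurable_fun [set: T] (fun t => \int[iid_law P k]_s f (pair_cons (t, s))).
Proof.
move=> mf f0.
apply: (@measurable_fun_fubini_tonelli_F _ _ _ _ _ (iid_law P k)
  (f \o @pair_cons _ _ k)) => [|x]; last exact: f0.
exact: measurableT_comp.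
Qed.

(** Neither [A] nor [B] need be integrable: moving the negative part of [u] to the
left leaves only integrals of nonnegative functions. *)
Lemma ge0_le_integralD (mu : {measure set T -> \bar R}) (A B : T -> \bar R)
    (u : T -> R) :
  measurable_fun [set: T] A -> measurable_fun [set: T] B ->
  mu.-integrable [set: T] (EFin \o u) ->
  (forall t, 0 <= A t) -> (forall t, 0 <= B t) ->
  (forall t, A t <= B t + (u t)%:E) ->
  \int[mu]_t A t <= \int[mu]_t B t + \int[mu]_t (u t)%:E.
Proof.
move=> mA mB iu A0 B0 AB; have mu' := measurable_int _ iu.
have /= fp := integrable_pos_fin_num measurableT iu.
have /= fn := integrable_neg_fin_num measurableT iu.
rewrite [X in _ <= _ + X]integralE addeA leeBrDr//.
rewrite -!ge0_integralD//; try exact: measurable_funepos;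
  try exact: measurable_funeneg.
apply: ge0_le_integral => //.
- by move=> t tT; apply: adde_ge0.
- by apply: emeasurable_funD => //; exact: measurable_funeneg.
- by apply: emeasurable_funD => //; exact: measurable_funepos.
move=> t _; rewrite -leeBrDr; last first.
  by rewrite funenegE -EFinN -EFin_max.
apply: (le_trans (AB t)); rewrite -addeA leeD2l//.
rewrite funeposE funenegE -EFinN -!EFin_max -EFinB lee_fin /Num.max.
by case: ifP; case: ifP; lra.
Qed.

Lemma measurable_prefix dU (V : measurableType dU) (k i : nat) (g : seq T -> V) :
  (i <= k)%N ->
  measurable_fun [set: i.-tuple T] (fun s : i.-tuple T => g s) ->
  measurable_fun [set: k.-tuple T] (fun s : k.-tuple T => g (take i s)).
Proof.
move=> ik mg.
pose tk (s : k.-tuple T) : i.-tuple T := [tuple tnth s (widen_ord ik j) | j < i].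
have tkE s : tk s = take i s :> seq T.
  case: i ik mg @tk => [|i] ik mg; first by rewrite take0; apply: size0nil; rewrite size_tuple.
  move=> tk.
  have x0 := tnth s (widen_ord ik ord0).
  apply: (@eq_from_nth _ x0); first by rewrite size_tuple size_takel// size_tuple.
  move=> j; rewrite size_tuple => ji.
  by rewrite nth_take// -(tnth_nth x0 _ (Ordinal ji)) tnth_mktuple (tnth_nth x0).
have -> : (fun s : k.-tuple T => g (take i s)) =
    (fun s : i.-tuple T => g s) \o tk by apply/funext => s /=; rewrite tkE.
apply: (measurableT_comp mg).
apply/measurable_fun_tnthP => j.
rewrite (_ : _ \o _ = (fun s : k.-tuple T => tnth s (widen_ord ik j))).
  exact: measurable_tnth.
by apply/funext => s /=; rewrite tnth_mktuple.
Qed.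

End iid_integral.

Section compensator.
Context (R : realType) (d : measure_display) (T : measurableType d).
Context (P : probability T R).

(** The compensated sum [a + \sum_i psi_i], where [psi_i] is the conditional mean
of [Y_i] given the first [i] samples, need not be integrable. If [\sum_i Y_i] is
bounded above by [c], its mean is nevertheless at most [a + c], in the sense that
survives infinite positive and negative parts. Integrating out the first sample
reduces [k.+1] to [k]; only nonnegative functions are ever integrated. *)
Lemma integral_compensator_le (k : nat) (Y : seq T -> T -> R) (a c : R) :
  let psi h := \int[P]_t Y h t in
  let Z := fun s : k.-tuple T => (a + \sum_(i < k) psi (take i s))%:E in
  (forall h, P.-integrable [set: T] (EFin \o Y h)) ->
  (forall i, (i < k)%N ->
     measurable_fun [set: i.-tuple T] (fun s : i.-tuple T => psi s)) ->
  (forall s : k.-tuple T, \sum_(i < k) Y (take i s) (tnth s i) <= c) ->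
  (\int[iid_law P k]_s Z^\+ s <= \int[iid_law P k]_s Z^\- s + (a + c)%:E)%E.
Proof.
elim: k Y a c => [|k IH] Y a c psi Z iY mpsi Yc.
  have := Yc [tuple]; rewrite big_ord0 => c0.
  have ZE s : Z s = a%:E by rewrite /Z big_ord0 addr0.
  under eq_integral do rewrite funeposE ZE.
  under [X in (_ <= X + _)%E]eq_integral do rewrite funenegE ZE.
  have cst (b : \bar R) : (\int[iid_law P 0]_s b = b)%E.
    rewrite integral_cst// -[RHS]mule1; congr (_ * _)%E.
    exact: (@probability_setT _ _ _ (iid_law P 0)).
  rewrite !cst -EFinN -!EFin_max -EFinD lee_fin.
  by rewrite /Num.max; case: ifP; case: ifP; lra.
have mZ : measurable_fun [set: k.+1.-tuple T] Z.
  apply/measurable_EFinP; apply: measurable_funD => //.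
  by apply: measurable_sum => i; apply: measurable_prefix; [exact: ltnW|exact: mpsi].
rewrite !ge0_integral_iid_lawS//; try exact: measurable_funepos;
  try exact: measurable_funeneg.
pose u t := a + psi [::] + (c - Y [::] t).
have iu : P.-integrable [set: T] (EFin \o u).
  rewrite (_ : EFin \o u = (fun=> (a + psi [::] + c)%:E) \- (EFin \o Y [::]))%E.
    by apply: integrableB => //; exact: finite_measure_integrable_cst.
  by apply/funext => t; rewrite /u /= addrA.
have -> : (a + c)%:E = (\int[P]_t (u t)%:E)%E.
  rewrite /u; under eq_integral do rewrite addrA EFinB.
  have ic := finite_measure_integrable_cst P (a + psi [::] + c).
  rewrite (integralB measurableT (ic _ measurableT) (iY [::])) /=.
  have -> : (\int[P]_t (a + psi [::] + c)%:E)%E = (a + psi [::] + c)%:E.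
    by rewrite integral_cst// -[RHS]mule1; congr (_ * _)%E; exact: probability_setT.
  have -> : (\int[P]_t (Y [::] t)%:E)%E = (psi [::])%:E.
    by rewrite /psi /Rintegral fineK//; exact: (integrable_fin_num measurableT (iY [::])).
  by rewrite -EFinB; congr EFin; ring.
apply: ge0_le_integralD => //.
- by apply: measurable_iid_section => //; exact: measurable_funepos.
- by apply: measurable_iid_section => //; exact: measurable_funeneg.
- by move=> t; apply: integral_ge0.
- by move=> t; apply: integral_ge0.
move=> t.
pose Z' (s : k.-tuple T) := (a + psi [::] + \sum_(i < k) psi (t :: take i s))%:E.
have ZE (s : k.-tuple T) : Z (pair_cons (t, s)) = Z' s.
  by rewrite /Z /Z' big_ord_recl /= addrA.
have -> : (\int[iid_law P k]_s Z^\+ (pair_cons (t, s)) =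
           \int[iid_law P k]_s Z'^\+ s)%E.
  by apply: eq_integral => s _; rewrite !funeposE ZE.
have -> : (\int[iid_law P k]_s Z^\- (pair_cons (t, s)) =
           \int[iid_law P k]_s Z'^\- s)%E.
  by apply: eq_integral => s _; rewrite !funenegE ZE.
apply: (IH (fun h => Y (t :: h)) (a + psi [::]) (c - Y [::] t)) => [h|i ik|s].
- exact: iY.
- have m2 := @pair1_measurable _ _ T (i.-tuple T) t.
  exact: measurableT_comp (mpsi i.+1 ik)
    (measurableT_comp (@measurable_pair_cons _ T i) m2).
- have := Yc (pair_cons (t, s)); rewrite big_ord_recl /= tnth0 lerBrDl.
  by under eq_bigr do rewrite tnthS.
Qed.

End compensator.

(** * From regret to stochastic risk *)

Section online_to_batch.
Context (R : realType) (n : nat).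

Definition batch_rule (k : nat) (xhat : seq ('rV[R]_n -> R) -> 'rV[R]_n)
    (l : seq ('rV[R]_n -> R)) : 'rV[R]_n :=
  k%:R^-1 *: \sum_(i < k) xhat (take i l).

Lemma observed_take (T : Type) (F : 'rV[R]_n -> T -> R) i s :
  observed F (take i s) = take i (observed F s).
Proof. by rewrite /observed map_take. Qed.

Lemma batch_rule_stochastic gamma (k : nat) d (T : measurableType d) xhat :
  online_strategy gamma k T xhat -> stochastic_rule gamma k T (batch_rule k xhat).
Proof.
move=> oxhat F lF j.
under eq_fun do rewrite /batch_rule mxE summxE.
apply: measurable_funM => //; apply: measurable_sum => i.
under eq_fun do rewrite -observed_take.
apply: (measurable_prefix (g := fun h => xhat (observed F h) 0 j)).
  exact: ltnW.
exact: oxhat.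
Qed.

Lemma expected_loss_fin d (T : measurableType d) (F : 'rV[R]_n -> T -> R)
    (P : probability T R) x : P.-integrable [set: T] (EFin \o F x) ->
  expected_loss F P x = (\int[P]_t F x t)%:E.
Proof.
by move=> iF; rewrite /expected_loss /Rintegral fineK// (integrable_fin_num measurableT iF).
Qed.

Lemma convex_expected_loss d (T : measurableType d) (F : 'rV[R]_n -> T -> R)
    (P : probability T R) :
  (forall t, convex_function [set: 'rV[R]_n] (F ^~ t)) ->
  (forall x, P.-integrable [set: T] (EFin \o F x)) ->
  convex_function [set: 'rV[R]_n] (fun x => \int[P]_t F x t).
Proof.
move=> cF iF; apply/convex_functionP => x y t t01.
have iZ (u : R) z : P.-integrable [set: T] (EFin \o (fun s => u * F z s)).
  rewrite (_ : EFin \o _ = (fun s => u%:E * (EFin \o F z) s)%E).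
    by apply: integrableZl => //; exact: iF.
  by apply/funext => s.
rewrite -!RintegralZl// -RintegralD//.
apply: le_Rintegral => //.
  rewrite (_ : EFin \o _ =
    (EFin \o (fun s => (t * F x s)%R)) \+ (EFin \o (fun s => ((1 - t) * F y s)%R)))%E.
    exact: integrableD.
  by apply/funext => s.
move=> s _; have /convex_functionP := cF s; exact.
Qed.

(** The average of the plays inherits, in expectation, any bound on the average
regret: a play depends only on earlier samples, so the loss it suffers has the
expected loss at that play as its conditional mean. *)
Lemma batch_excess_risk_le gamma (X : set 'rV[R]_n) (k : nat) d
    (T : measurableType d) (F : 'rV[R]_n -> T -> R) (P : probability T R) xhat c :
  (0 < k)%N -> X !=set0 -> compact X ->
  online_strategy gamma k T xhat -> loss_class gamma T F ->
  (forall x, P.-integrable [set: T] (EFin \o F x)) ->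
  (forall (s : k.-tuple T) x, X x -> k%:R^-1 * \sum_(i < k)
     (F (xhat (observed F (take i s))) (tnth s i) - F x (tnth s i)) <= c) ->
  (excess_risk X k F P (batch_rule k xhat) <= c%:E)%E.
Proof.
move=> k0 X0 cX oxhat lF iF Fc.
have [cF _ _] := lF.
pose f x := \int[P]_t F x t.
have cf : convex_function [set: 'rV[R]_n] f by exact: convex_expected_loss.
have [x0 Xx0 x0min] : exists2 x0, X x0 & forall x, X x -> f x0 <= f x.
  have [x0 Xx0 x0min] := @EVT_min_rV _ _ f X X0 cX
    (continuous_subspaceT (convex_continuous cf)).
  by exists x0 => [|x Xx]; [rewrite inE in Xx0|apply: x0min; rewrite inE].
have infE : ereal_inf [set expected_loss F P x | x in X] = (f x0)%:E.
  apply/eqP; rewrite eq_le; apply/andP; split.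
    by apply: ereal_inf_lbound; exists x0; rewrite // expected_loss_fin.
  by apply: le_ereal_inf_tmp => _ [x Xx <-]; rewrite expected_loss_fin// lee_fin x0min.
have kR : 0 < k%:R :> R by rewrite ltr0n.
pose Y h t := k%:R^-1 * (F (xhat (observed F h)) t - F x0 t).
have iB h : P.-integrable [set: T]
    (EFin \o (fun t => F (xhat (observed F h)) t - F x0 t)).
  exact: (integrableB measurableT (iF _) (iF _)).
have YE h : \int[P]_t Y h t = k%:R^-1 * (f (xhat (observed F h)) - f x0).
  by rewrite RintegralZl// ?RintegralB.
pose W (s : k.-tuple T) : \bar R := (f (batch_rule k xhat (observed F s)) - f x0)%:E.
pose Z (s : k.-tuple T) : \bar R := (0 + \sum_(i < k) \int[P]_t Y (take i s) t)%:E.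
have WZ s : (W s <= Z s)%E.
  rewrite lee_fin add0r; under eq_bigr do rewrite YE.
  have w0 (i : 'I_k) : 0 <= k%:R^-1 :> R by rewrite invr_ge0 ltW.
  have w1 : \sum_(i < k) k%:R^-1 <= 1 :> R.
    by rewrite sumr_const card_ord -(mulr_natl k%:R^-1) mulfV// gt_eqF.
  have := convex_jensen cf (fun i : 'I_k => xhat (observed F (take i s)) - x0)
    x0 w0 w1.
  have -> : x0 + \sum_(i < k) k%:R^-1 *: (xhat (observed F (take i s)) - x0) =
            batch_rule k xhat (observed F s).
    rewrite -scaler_sumr sumrB sumr_const card_ord scalerBr.
    rewrite -(scaler_nat k x0) scalerA mulVf ?gt_eqF// scale1r addrC subrK.
    by rewrite /batch_rule; under eq_bigr do rewrite observed_take.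
  move=> /le_trans; apply.
  by apply: ler_sum => i _; rewrite [x0 + _]addrC subrK.
rewrite /excess_risk infE; under eq_integral => s _ do
  rewrite expected_loss_fin// -EFinB -/(f _) -/(W s).
have mf (i : nat) (h : i.-tuple T -> 'rV[R]_n) :
    measurable_rV h -> measurable_fun [set: i.-tuple T] (f \o h).
  by move=> mh; apply: (@measurable_convex_comp _ _ _ _ (fun=> f)).
have mW : measurable_fun [set: k.-tuple T] W.
  apply/measurable_EFinP; apply: measurable_funB => //.
  by apply: mf; exact: (batch_rule_stochastic oxhat lF).
have mpsi (i : nat) : (i < k)%N ->
    measurable_fun [set: i.-tuple T] (fun s : i.-tuple T => \int[P]_t Y s t).
  move=> ik; under eq_fun do rewrite YE.
  apply: measurable_funM => //; apply: measurable_funB => //.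
  by apply: mf; exact: (oxhat (Ordinal ik) _ lF).
have mZ : measurable_fun [set: k.-tuple T] Z.
  apply/measurable_EFinP; apply: measurable_funD => //.
  apply: measurable_sum => i.
  apply: (measurable_prefix (g := fun h => \int[P]_t Y h t)).
    exact: ltnW.
  exact: mpsi.
have iY h : P.-integrable [set: T] (EFin \o Y h).
  exact: (integrableZl measurableT _ (iB h)).
have YP (s : k.-tuple T) : \sum_(i < k) Y (take i s) (tnth s i) <= c.
  by rewrite -mulr_sumr; exact: Fc.
have := integral_compensator_le 0 iY mpsi YP; rewrite -/Z add0r => H.
(* W and Z need not be integrable, so their parts are compared separately *)
have Wp : (\int[iid_law P k]_s W^\+ s <= \int[iid_law P k]_s Z^\+ s)%E.
  apply: ge0_le_integral => //; try exact: measurable_funepos.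
  by move=> s sT; apply: (@funepos_le _ _ [set: k.-tuple T] W Z) => [u _|]; [exact: WZ|rewrite inE].
have Wn : (\int[iid_law P k]_s Z^\- s <= \int[iid_law P k]_s W^\- s)%E.
  apply: ge0_le_integral => //; try exact: measurable_funeneg.
  by move=> s sT; apply: (@funeneg_le _ _ [set: k.-tuple T] W Z) => [u _|]; [exact: WZ|rewrite inE].
have {}H := le_trans Wp (le_trans H (leeD2r _ Wn)).
have W0 : (0 <= \int[iid_law P k]_s W^\- s)%E by exact: integral_ge0.
rewrite integralE; move: H W0.
set q := (\int[iid_law P k]_s W^\- s)%E; case: q => [b| |]// H _.
  by rewrite leeBlDr// addeC.
by rewrite /= addeNy leNye.
Qed.

Lemma minimax_stochastic_risk_le_regret gamma (X : set 'rV[R]_n) (k : nat) :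
  (0 < k)%N -> X !=set0 -> compact X ->
  (minimax_stochastic_risk k X gamma <= minimax_regret k X gamma)%E.
Proof.
move=> k0 X0 cX; apply: ge_ereal_sup => _ [d [T ->]].
apply: le_ereal_sup_tmp; eexists; first by exists d, T.
apply: le_ereal_inf_tmp => w [xhat oxhat ->].
apply: ge_ereal_inf; eexists.
  by exists (batch_rule k xhat) => //; exact: batch_rule_stochastic.
apply: ge_ereal_sup => _ [F [P [lF iF ->]]].
set w' := ereal_sup _.
have rw (s : k.-tuple T) :
    (average_regret X F s (fun i : 'I_k => xhat (observed F (take i s))) <= w')%E.
  by apply: ereal_sup_ubound; exists F, s.
have rle (s : k.-tuple T) x : X x -> ((k%:R^-1 * \sum_(i < k)
    (F (xhat (observed F (take i s))) (tnth s i) - F x (tnth s i)))%:E <= w')%E.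
  move=> Xx; apply: le_trans (rw s); apply: ereal_sup_ubound.
  by exists x.
case: w' {rw} rle => [c rle|_|rle]; last 1 first.
- (* a space carrying a probability is inhabited, so some regret is finite *)
  have [t _] : [set: T] !=set0.
    apply/set0P/eqP => T0; have := probability_setT P.
    by rewrite T0 measure0 => /eqP; rewrite lt_eqF.
  by case: X0 => x Xx; have := rle [tuple of nseq k t] x Xx; rewrite leNgt ltNyr.
- by apply: (batch_excess_risk_le k0 X0 cX oxhat lF iF) => s x Xx; exact: rle.
- exact: leey.
Qed.

End online_to_batch.

(** * Finite probability spaces *)

Section finite_space.
Context (I : finType) (i0 : I).

(** The type depends on [i0] because measurable types are pointed. *)
Definition discrete : Type := let _ := i0 in I.

HB.instance Definition _ := Finite.on discrete.
HB.instance Definition _ := isPointed.Build discrete i0.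
HB.instance Definition _ := @isMeasurable.Build default_measure_display
  discrete discrete_measurable discrete_measurable0
  discrete_measurableC discrete_measurableU.

Lemma measurable_discrete_tuple (k : nat) (A : set (k.-tuple discrete)) :
  measurable A.
Proof.
rewrite (_ : A = \bigcup_(s in A) [set s]); last first.
  by apply/seteqP; split=> [s As|s [u Au ->]//]; exists s.
apply: fin_bigcup_measurable; first exact: finite_finset.
move=> s _; rewrite (_ : [set s] = \bigcap_(i in [set: 'I_k])
    ((fun u : k.-tuple discrete => tnth u i) @^-1` [set tnth s i])).
  apply: fin_bigcap_measurable; first exact: finite_finset.
  move=> i _; rewrite -[X in measurable X]setTI.
  exact: measurable_tnth.
apply/seteqP; split=> [u ->//|u us /=].
by apply: eq_from_tnth => i; exact: us.
Qed.

Lemma measurable_fun_discrete_tuple (k : nat) d (V : measurableType d)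
    (f : k.-tuple discrete -> V) : measurable_fun [set: k.-tuple discrete] f.
Proof. by move=> _ B _; exact: measurable_discrete_tuple. Qed.

Lemma measurable_fun_discrete d (V : measurableType d) (f : discrete -> V) :
  measurable_fun [set: discrete] f.
Proof. by []. Qed.

End finite_space.

Section finite_integral.
Context (R : realType) (I : finType) d (U : measurableType d) (h : I -> U).
Local Open Scope ereal_scope.

(** The map [h] serves to identify a finite type with a measurable copy of it. *)
Lemma ge0_integral_finite (mu : {measure set U -> \bar R}) (g : U -> R) :
  injective h -> (forall u, exists i, h i = u) ->
  (forall A : set U, measurable A) -> (forall u, (0 <= g u)%R) ->
  \int[mu]_u (g u)%:E = \sum_(i : I) (g (h i))%:E * mu [set h i].
Proof.
move=> hinj hsurj mA g0.
have mg : measurable_fun [set: U] (EFin \o g) by move=> _ B _; exact: mA.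
have UE : [set: U] = \big[setU/set0]_(i <- index_enum I) [set h i].
  apply/seteqP; split=> // u _; have [i <-] := hsurj u.
  by rewrite -bigcup_seq; exists i => //=; rewrite mem_index_enum.
rewrite UE ge0_integral_bigsetU//.
- apply: eq_bigr => i _.
  rewrite -(integral_cst mu (mA [set h i])); apply: eq_integral => u.
  by rewrite inE => ->.
- exact: index_enum_uniq.
- by move=> i j _ _ [u [/= -> /hinj]].
- by move=> u _; rewrite lee_fin.
Qed.

End finite_integral.

Section finite_law.
Context (R : realType) (I : finType) (i0 : I) (w : I -> R).
Context (w0 : forall t, 0 <= w t) (w1 : \sum_t w t = 1).
Local Open Scope ereal_scope.
Let D := discrete i0.

(** The point masses are summed along an enumeration of [I], since finite sums of
measures are indexed by natural numbers. *)
Definition finite_law : set D -> \bar R :=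
  msum (fun m => mscale (NngNum (w0 (nth i0 (enum I) m)))
                        (dirac (nth i0 (enum I) m : D))) #|I|.

HB.instance Definition _ := Measure.on finite_law.

Lemma finite_lawE (A : set D) : finite_law A = \sum_(t : I) (w t)%:E * \d_(t : D) A.
Proof.
rewrite /finite_law /msum -(big_mkord xpredT (fun m =>
  (w (nth i0 (enum I) m))%:E * \d_(nth i0 (enum I) m : D) A)).
rewrite cardE.
by rewrite -(big_nth i0 xpredT (fun t => (w t)%:E * \d_(t : D) A)) big_enum.
Qed.

Let finite_law_setT : finite_law [set: D] = 1.
Proof.
rewrite finite_lawE; under eq_bigr do rewrite diracT mule1.
by rewrite sumEFin w1.
Qed.

HB.instance Definition _ := Measure_isProbability.Build _ _ _
  finite_law finite_law_setT.

Definition finite_probability : probability D R := finite_law.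

Lemma finite_probability1 t : finite_probability [set t] = (w t)%:E.
Proof.
rewrite [LHS]finite_lawE (@bigD1 _ _ _ I t)//= diracE mem_set// mule1 big1 ?adde0// => u ut.
rewrite diracE memNset ?mule0// => /= tu.
by move: ut; rewrite tu eqxx.
Qed.

Lemma integral_finite_probability (g : D -> R) : (forall t, (0 <= g t)%R) ->
  \int[finite_probability]_t (g t)%:E = (\sum_t w t * g t)%:E.
Proof.
move=> g0; rewrite (ge0_integral_finite (h := id : I -> D))//.
  rewrite -sumEFin; apply: eq_bigr => t _; rewrite EFinM muleC.
  by congr (_ * _); exact: finite_probability1.
by move=> u; exists u.
Qed.

Lemma finite_probability_integrable (g : D -> R) :
  finite_probability.-integrable [set: D] (EFin \o g).
Proof.
apply/integrableP; split; first by [].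
under eq_integral => t _ do rewrite /= .
rewrite (integral_finite_probability (g := fun t => `|g t|%R))// ltry//.
Qed.

Lemma integral_iid_finite_probability (k : nat) (g : k.-tuple D -> R) :
  (forall s, (0 <= g s)%R) ->
  \int[iid_law finite_probability k]_s (g s)%:E =
  (\sum_(s : k.-tuple I) (\prod_(i < k) w (tnth s i)) * g s)%:E.
Proof.
move=> g0; rewrite (ge0_integral_finite (h := id : k.-tuple I -> k.-tuple D))//.
- rewrite -sumEFin; apply: eq_bigr => s _.
  rewrite EFinM muleC; congr (_ * _).
  have -> : [set s : k.-tuple D] = [set u | forall i, [set tnth s i : D] (tnth u i)].
    apply/seteqP; split=> [u -> //|u us]; apply: eq_from_tnth => i; exact: us.
  apply: etrans (@iid_lawE _ _ _ finite_probability k (fun i => [set (tnth s i : D)]) _) _.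
    by [].
  by rewrite -prodEFin; apply: eq_bigr => i _; exact: finite_probability1.
- by move=> u; exists u.
- exact: measurable_discrete_tuple.
Qed.

End finite_law.

(** * Indistinguishable signs *)

Section two_point.
Context (R : realType).

Lemma sum_tuple_prod (I : finType) (k : nat) (f : I -> R) :
  \sum_(s : k.-tuple I) \prod_(i < k) f (tnth s i) = (\sum_t f t) ^+ k.
Proof.
rewrite (reindex (fun g : {ffun 'I_k -> I} => [tuple g i | i < k])) /=; last first.
  exists (fun s : k.-tuple I => [ffun i => tnth s i]) => [g _|s _].
    by apply/ffunP => i; rewrite ffunE tnth_mktuple.
  by apply: eq_from_tnth => i; rewrite tnth_mktuple ffunE.
under eq_bigr do under eq_bigr do rewrite tnth_mktuple.
by rewrite -(bigA_distr_bigA (fun _ t => f t)) prodr_const card_ord.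
Qed.

Lemma bernoulli_expr (x : R) (k : nat) : 0 <= x <= 1 -> 1 - k%:R * x <= (1 - x) ^+ k.
Proof.
move=> /andP[x0 x1]; elim: k => [|k IH]; first by rewrite expr0 mul0r subr0.
rewrite exprS; apply: (@le_trans _ _ ((1 - x) * (1 - k%:R * x))).
  rewrite -[k.+1%:R]natr1; have : 0 <= k%:R * x * x by rewrite !mulr_ge0.
  lra.
by rewrite ler_wpM2l// subr_ge0.
Qed.

(** Le Cam's two-point bound for the products of [q (1 + e)] and [q (1 - e)]. Their
densities with respect to the product of [q] have second moments [(1 + rho)^k]
and cross moment [(1 - rho)^k]; for [k rho <= 1 / 4] these are at most [4 / 3] and
at least [3 / 4], which leaves an overlap of [1 - 1 / 4 - (4 / 3 - 3 / 4) / 2 = 11 / 24]. *)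
Lemma product_overlap_ge (I : finType) (k : nat) (q e : I -> R) (rho : R) :
  (forall t, 0 <= q t) -> \sum_t q t = 1 -> \sum_t q t * e t = 0 ->
  \sum_t q t * e t ^+ 2 = rho -> (0 < k)%N -> k%:R * rho <= 4^-1 ->
  11 / 24 <= \sum_(s : k.-tuple I)
    Num.min (\prod_(i < k) (q (tnth s i) * (1 + e (tnth s i))))
            (\prod_(i < k) (q (tnth s i) * (1 - e (tnth s i)))).
Proof.
move=> q0 q1 qe qee k0 krho.
have rho0 : 0 <= rho.
  by rewrite -qee sumr_ge0// => t _; rewrite mulr_ge0 ?sqr_ge0.
have rho1 : rho <= 1.
  have : 1 <= k%:R :> R by rewrite ler1n.
  move=> k1; have : rho <= k%:R * rho by rewrite ler_peMl.
  lra.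
pose Q (s : k.-tuple I) := \prod_(i < k) q (tnth s i).
pose A (z : R) (s : k.-tuple I) := \prod_(i < k) (1 + z * e (tnth s i)).
have QE (z z' : R) : \sum_s Q s * (A z s * A z' s) = (1 + z * z' * rho) ^+ k.
  rewrite /Q /A.
  under eq_bigr do rewrite -!big_split/=.
  rewrite (sum_tuple_prod k (fun t => q t * ((1 + z * e t) * (1 + z' * e t)))).
  congr (_ ^+ k).
  transitivity (\sum_t (q t + (z + z') * (q t * e t) + z * z' * (q t * e t ^+ 2))).
    by apply: eq_bigr => t _; ring.
  by rewrite !big_split/= -!mulr_sumr q1 qe qee mulr0 addr0.
have A0 s : A 0 s = 1 by rewrite /A big1// => i _; rewrite mul0r addr0.
have QA z : \sum_s Q s * A z s = 1.
  transitivity (\sum_s Q s * (A z s * A 0 s)).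
    by apply: eq_bigr => s _; rewrite A0 mulr1.
  by rewrite QE mulr0 mul0r addr0 expr1n.
have QT : \sum_s Q s = 1.
  by rewrite -(QA 0); apply: eq_bigr => s _; rewrite A0 mulr1.
have hm : 3 / 4 <= (1 - rho) ^+ k.
  by apply: le_trans (bernoulli_expr k _); [lra|rewrite rho0 rho1].
have hp : (1 + rho) ^+ k <= 4 / 3.
  have h1 : (1 + rho) ^+ k * (1 - rho) ^+ k <= 1.
    rewrite -exprMn -[leRHS](expr1n _ k) lerXn2r ?nnegrE//.
      by rewrite mulr_ge0; lra.
    by have := sqr_ge0 rho; rewrite expr2; lra.
  have h2 : 0 <= (1 + rho) ^+ k by rewrite exprn_ge0//; lra.
  have : (1 + rho) ^+ k * (3 / 4) <= (1 + rho) ^+ k * (1 - rho) ^+ k.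
    by rewrite ler_wpM2l.
  lra.
(* min(a, b) = (a + b) / 2 - |a - b| / 2 and |d| <= (d^2 + 1) / 2 *)
apply: (@le_trans _ _ (\sum_(s : k.-tuple I) Q s * ((A 1 s + A (-1) s) / 2
    - (A 1 s * A 1 s + A (-1) s * A (-1) s - 2 * (A 1 s * A (-1) s)) / 4 - 4^-1))).
  have -> : \sum_(s : k.-tuple I) Q s * ((A 1 s + A (-1) s) / 2
    - (A 1 s * A 1 s + A (-1) s * A (-1) s - 2 * (A 1 s * A (-1) s)) / 4 - 4^-1) =
    (\sum_s Q s * A 1 s + \sum_s Q s * A (-1) s) / 2 -
    (\sum_s Q s * (A 1 s * A 1 s) + \sum_s Q s * (A (-1) s * A (-1) s)
     - 2 * \sum_s Q s * (A 1 s * A (-1) s)) / 4 - (\sum_s Q s) / 4.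
    rewrite mulr_sumr -sumrN -!big_split/= !mulr_suml -!sumrN -!big_split/=.
    by apply: eq_bigr => s _; field.
  rewrite !QA !QE QT mulrNN !mul1r mulN1r; lra.
apply: ler_sum => s _.
have Q0 : 0 <= Q s by apply: prodr_ge0.
have -> : \prod_(i < k) (q (tnth s i) * (1 + e (tnth s i))) = Q s * A 1 s.
  by rewrite -big_split; apply: eq_bigr => i _; rewrite mul1r.
have -> : \prod_(i < k) (q (tnth s i) * (1 - e (tnth s i))) = Q s * A (-1) s.
  by rewrite -big_split; apply: eq_bigr => i _; rewrite mulN1r.
rewrite -minr_pMr// ler_wpM2l//.
move: (A 1 s) (A (-1) s) => a b.
have := sqr_ge0 ((a - b) / 2 - 2^-1); have := sqr_ge0 ((a - b) / 2 + 2^-1).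
rewrite !expr2 /Num.min; case: ifP => _; lra.
Qed.

End two_point.

Section assouad.
Context (R : realType) (n : nat).

Definition signr (b : bool) : R := if b then 1 else -1.

Definition flip (j : 'I_n) (v : {ffun 'I_n -> bool}) : {ffun 'I_n -> bool} :=
  [ffun i => if i == j then ~~ v i else v i].

Lemma flipK j : involutive (flip j).
Proof. by move=> v; apply/ffunP => i; rewrite !ffunE; case: eqP => // _; rewrite negbK. Qed.

(** A sample is a coordinate [j], drawn with probability [p j], and a coin whose
bias [delta j] points to the hidden sign [v j]. *)
Definition coin_weight (p delta : 'I_n -> R) (v : {ffun 'I_n -> bool})
    (t : 'I_n * bool) : R :=
  p t.1 * ((1 + delta t.1 * signr (v t.1) * signr t.2) / 2).

Lemma coin_weight_sum p delta v : \sum_j p j = 1 ->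
  \sum_t coin_weight p delta v t = 1.
Proof.
move=> p1; rewrite -(pair_bigA _ (fun j b => coin_weight p delta v (j, b)))/= -p1.
by apply: eq_bigr => j _; rewrite big_bool /coin_weight /=; field.
Qed.

Lemma coin_weight_ge0 p delta v t : (forall j, 0 <= p j) ->
  (forall j, 0 <= delta j <= 1) -> 0 <= coin_weight p delta v t.
Proof.
move=> p0 d01; rewrite mulr_ge0//; have /andP[] := d01 t.1.
by rewrite /signr; case: (v _); case: (t.2); lra.
Qed.

(** Assouad's lemma. Flipping one coordinate pairs up the sign vectors; the laws of
a pair overlap by [11 / 24], and on the overlap the decision about this coordinate
is wrong for one of the two. So each sign is missed with mean probability at least
[11 / 48] over all sign vectors, and some vector does no better than the mean. *)
Lemma assouad (k : nat) (p delta c : 'I_n -> R)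
    (wrong : 'I_n -> bool -> k.-tuple ('I_n * bool) -> bool) :
  (0 < k)%N -> (forall j, 0 <= p j) -> \sum_j p j = 1 ->
  (forall j, 0 <= delta j <= 1) -> (forall j, k%:R * (p j * delta j ^+ 2) <= 4^-1) ->
  (forall j, 0 <= c j) -> (forall j s, wrong j true s || wrong j false s) ->
  exists v, 11 / 48 * \sum_j c j <= \sum_(s : k.-tuple ('I_n * bool))
    (\prod_(i < k) coin_weight p delta v (tnth s i)) *
    \sum_j c j * (wrong j (v j) s)%:R.
Proof.
move=> k0 p0 p1 d01 kpd c0 wr.
pose Wt v (s : k.-tuple ('I_n * bool)) := \prod_(i < k) coin_weight p delta v (tnth s i).
pose Y j v := \sum_s Wt v s * (wrong j (v j) s)%:R.
have Wt0 v s : 0 <= Wt v s by apply: prodr_ge0 => i _; exact: coin_weight_ge0.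
have YY j v : 11 / 24 <= Y j v + Y j (flip j v).
  (* q forgets the sign in coordinate j; e restores it *)
  pose q t := if t.1 == j then p j / 2 else coin_weight p delta v t.
  pose e t := if t.1 == j then delta j * signr (v j) * signr t.2 else 0.
  have sq b : signr b * signr b = 1 by rewrite /signr; case: b; rewrite ?mulrNN mulr1.
  have q0 t : 0 <= q t.
    by rewrite /q; case: eqP => _; [rewrite divr_ge0|exact: coin_weight_ge0].
  have q1 : \sum_t q t = 1.
    rewrite -(pair_bigA _ (fun j b => q (j, b)))/= -p1.
    apply: eq_bigr => i _; rewrite big_bool /q /coin_weight /=.
    by case: eqP => [->|_]; field.
  have qe : \sum_t q t * e t = 0.
    rewrite -(pair_bigA _ (fun j b => q (j, b) * e (j, b)))/=.
    apply: big1 => i _; rewrite big_bool /q /e /=.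
    by case: eqP => _; rewrite /signr; ring.
  have qee : \sum_t q t * e t ^+ 2 = p j * delta j ^+ 2.
    rewrite -(pair_bigA _ (fun j b => q (j, b) * e (j, b) ^+ 2))/=.
    rewrite (bigD1 j)//= [X in _ + X]big1 ?addr0 => [|i ij]; last first.
      by apply: big1 => b _; rewrite /e /= (negPf ij) expr0n mulr0.
    rewrite big_bool /q /e /= eqxx; have := sq (v j).
    by rewrite /signr; case: (v j) => _; field.
  have := product_overlap_ge q0 q1 qe qee k0 (kpd j) => /le_trans; apply.
  rewrite /Y -big_split/=; apply: ler_sum => s _.
  have -> : \prod_(i < k) (q (tnth s i) * (1 + e (tnth s i))) = Wt v s.
    apply: eq_bigr => i _; rewrite /q /e /coin_weight.
    by case: eqP => [->|_]; field.
  have -> : \prod_(i < k) (q (tnth s i) * (1 - e (tnth s i))) = Wt (flip j v) s.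
    apply: eq_bigr => i _; rewrite /q /e /coin_weight ffunE.
    case: eqP => [->|_]; last by field.
    by rewrite /signr; case: (v j) => /=; field.
  have -> : flip j v j = ~~ v j by rewrite ffunE eqxx.
  have : wrong j (v j) s || wrong j (~~ v j) s.
    by have := wr j s; case: (v j) => //=; rewrite orbC.
  have H1 := Wt0 v s; have H2 := Wt0 (flip j v) s.
  case/orP => ->; rewrite mulr1.
    by rewrite ge_min lerDl mulr_ge0 ?ler0n.
  by rewrite ge_min lerDr mulr_ge0 ?ler0n ?orbT.
pose N : R := #|{: {ffun 'I_n -> bool}}|%:R.
have sumY j : 11 / 48 * N <= \sum_v Y j v.
  have E : \sum_v Y j v = \sum_v Y j (flip j v).
    by rewrite [LHS](reindex_inj (inv_inj (@flipK j))).
  suff : \sum_(v : {ffun 'I_n -> bool}) (11 / 24 : R) <= \sum_v Y j v + \sum_v Y j v.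
    by rewrite sumr_const -mulr_natr -/N; lra.
  by rewrite {2}E -big_split/=; apply: ler_sum => v _; exact: YY.
apply/not_existsP => H.
pose X v := \sum_s Wt v s * \sum_j c j * (wrong j (v j) s)%:R.
have XE v : X v = \sum_j c j * Y j v.
  rewrite /X; under eq_bigr do rewrite mulr_sumr.
  rewrite exchange_big/=; apply: eq_bigr => j _; rewrite mulr_sumr.
  by apply: eq_bigr => s _; ring.
have : \sum_v X v < \sum_(v : {ffun 'I_n -> bool}) (11 / 48 * \sum_j c j).
  apply: ltr_sum; first by apply/hasP; exists [ffun=> true].
  by move=> v _; rewrite ltNge; apply/negP; exact: H.
apply/negP; rewrite -leNgt sumr_const -(mulr_natr (11 / 48 * _)) -/N.
rewrite (eq_bigr _ (fun v _ => XE v)) exchange_big/=.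
have -> : 11 / 48 * (\sum_j c j) * N = \sum_j c j * (11 / 48 * N).
  by rewrite -mulr_suml; ring.
by apply: ler_sum => j _; rewrite -mulr_sumr ler_wpM2l//; exact: sumY.
Qed.

End assouad.

(** * Lower bound on the stochastic risk *)

(** With [A] and [B] the distances from [y] to the favoured and to the other one of
[u] and [- u], the weighted mean is [(A + B) / 2 + e (A - B) / 2], where
[A + B >= 2 u] and [A - B >= - 2 u], and even [A >= B] if [y] is closer to the
other one. The minimum [(1 - e) u] is attained at the favoured point. *)
Lemma biased_abs_gap (R : realType) (u e y : R) (b : bool) : 0 <= u -> 0 <= e <= 1 ->
  e * u * (signr R b * y <= 0)%R%:R <=
  (1 + e * signr R b) / 2 * `|y - u| + (1 - e * signr R b) / 2 * `|y + u| -
  (1 - e) * u.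
Proof.
move=> u0 /andP[e0 e1].
have H (A B : R) (c : bool) : 2 * u <= A + B -> B - A <= 2 * u -> (c -> B <= A) ->
    e * u * c%:R <= (1 + e) / 2 * A + (1 - e) / 2 * B - (1 - e) * u.
  move=> h1 h2 h3.
  have : 0 <= e * ((A - B) / 2 + u) by rewrite mulr_ge0//; lra.
  case: c h3 => h3; last by rewrite mulr0; lra.
  have : 0 <= e * (A - B) by rewrite mulr_ge0// subr_ge0; exact: h3.
  rewrite mulr1; lra.
have := ler_norm (y - u); have := ler_norm (y + u).
have := ler_norm (- (y - u)); have := ler_norm (- (y + u)).
rewrite !normrN => n1 n2 n3 n4.
have t1 : `|y + u| <= `|y - u| + 2 * u by rewrite ler_norml; apply/andP; split; lra.
have t2 : `|y - u| <= `|y + u| + 2 * u by rewrite ler_norml; apply/andP; split; lra.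
case: b; rewrite /signr.
  rewrite mul1r mulr1; apply: H; [lra|lra|move=> y0].
  by rewrite ler_norml; apply/andP; split; lra.
rewrite mulN1r mulrN1 opprK oppr_le0 [X in _ <= X - _]addrC.
apply: H; [lra|lra|move=> y0].
by rewrite ler_norml; apply/andP; split; lra.
Qed.

Section lower_bound.
Context (R : realType) (n : nat) (j0 : 'I_n).
Context (r : R) (r0 : 0 < r) (beta : 'rV[R]_n) (b0 : forall j, 0 < beta 0 j).
Let gamma (g : 'rV[R]_n) := lr_norm r (hadamard beta g).
Let coins := discrete (j0, true).

(** Only one coordinate enters each loss, and division by [beta_j] makes its slope
a vector of unit [gamma]-norm. *)
Definition coin_loss (a : 'I_n -> R) (y : 'rV[R]_n) (t : coins) : R :=
  let: (j, b) := t : 'I_n * bool in `|y 0 j - signr R b * a j| / beta 0 j.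

Lemma coin_loss_ge0 a y t : 0 <= coin_loss a y t.
Proof. by case: t => j b; rewrite divr_ge0// ltW. Qed.

(** Subgradients are multiples of a basis vector [e_j], and [gamma e_j = beta_j]. *)
Lemma coin_loss_class a : loss_class gamma coins (coin_loss a).
Proof.
split=> [[j b]|y|y [j b] g sg].
- apply/convex_functionP => x y t /andP[t0 t1].
  rewrite /coin_loss /= !mulrA -mulrDl ler_pM2r ?invr_gt0//.
  have -> : (t *: x + (1 - t) *: y) 0 j - signr R b * a j =
      t * (x 0 j - signr R b * a j) + (1 - t) * (y 0 j - signr R b * a j).
    by rewrite !mxE; ring.
  apply: (le_trans (ler_normD _ _)); rewrite !normrM (ger0_norm t0).
  by rewrite (ger0_norm (_ : 0 <= 1 - t)) ?subr_ge0.
- exact: measurable_fun_discrete.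
have dd i (c : R) : dotprod g ((y + c *: delta_mx 0 i) - y) = c * g 0 i.
  rewrite addrC addKr /dotprod (bigD1 i)//= big1 ?addr0 => [|l li]; last first.
    by rewrite !mxE (negPf li) andbF !mulr0.
  by rewrite !mxE !eqxx mulr1 mulrC.
have gi i (c : R) : coin_loss a y (j, b) + c * g 0 i <=
    coin_loss a (y + c *: delta_mx 0 i) (j, b).
  by rewrite -dd; exact: sg.
have g0 i : i != j -> g 0 i = 0.
  move=> ij; have e (c : R) : coin_loss a (y + c *: delta_mx 0 i) (j, b) =
      coin_loss a y (j, b).
    by rewrite /coin_loss /= !mxE eq_sym (negPf ij) andbF mulr0 addr0.
  by have := gi i 1; have := gi i (-1); rewrite !e; lra.
have gj : `|beta 0 j * g 0 j| <= 1.
  have e (c : R) : coin_loss a (y + c *: delta_mx 0 j) (j, b) <=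
      coin_loss a y (j, b) + `|c| / beta 0 j.
    rewrite /coin_loss /= !mxE !eqxx mulr1 -mulrDl ler_pM2r ?invr_gt0//.
    by rewrite addrAC; exact: ler_normD.
  have := le_trans (gi j 1) (e 1); have := le_trans (gi j (-1)) (e (-1)).
  rewrite normrN1 normr1 !lerD2l => h1 h2.
  rewrite normrM gtr0_norm// mulrC -ler_pdivlMr// ler_norml.
  by apply/andP; split; lra.
rewrite /gamma (_ : hadamard beta g = (beta 0 j * g 0 j) *: delta_mx 0 j).
  by rewrite lr_norm_delta.
apply/rowP => i; rewrite !mxE; have [->|ij] := eqVneq i j.
  by rewrite eqxx mulr1.
by rewrite g0// mulr0 andbF mulr0.
Qed.

Section risk.
Context (a : 'I_n -> R) (a0 : forall j, 0 <= a j).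
Context (p delta : 'I_n -> R) (p0 : forall j, 0 <= p j) (p1 : \sum_j p j = 1).
Context (d01 : forall j, 0 <= delta j <= 1).

Let w0 v t : 0 <= coin_weight p delta v t. Proof. exact: coin_weight_ge0. Qed.
Let w1 v : \sum_t coin_weight p delta v t = 1. Proof. exact: coin_weight_sum. Qed.

Definition coin_law v : probability coins R := finite_probability (j0, true) (w0 v) (w1 v).

Let mean_loss v y := \sum_t coin_weight p delta v t * coin_loss a y t.

Lemma expected_coin_loss v y :
  expected_loss (coin_loss a) (coin_law v) y = (mean_loss v y)%:E.
Proof.
by apply: integral_finite_probability => t; exact: coin_loss_ge0.
Qed.

Definition vertex (v : {ffun 'I_n -> bool}) : 'rV[R]_n := \row_j (signr R (v j) * a j).

Let gain j := p j * delta j * (a j / beta 0 j).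

Let gain0 j : 0 <= gain j.
Proof.
have /andP[dj _] := d01 j.
by rewrite /gain mulr_ge0 ?mulr_ge0 ?invr_ge0// ltW.
Qed.

Lemma mean_loss_gap (v : {ffun 'I_n -> bool}) (y : 'rV[R]_n) :
  \sum_j gain j * (signr R (v j) * y 0 j <= 0)%R%:R <=
  mean_loss v y - mean_loss v (vertex v).
Proof.
rewrite /mean_loss -sumrB.
pose G j b := coin_weight p delta v (j, b) * coin_loss a y (j, b) -
  coin_weight p delta v (j, b) * coin_loss a (vertex v) (j, b).
rewrite (eq_bigr (fun t => G t.1 t.2)) => [|[]//]; rewrite -(pair_bigA _ G).
apply: ler_sum => j _; rewrite big_bool /G /coin_loss /coin_weight /= !mxE.
have h := biased_abs_gap (y 0 j) (v j) (a0 j) (d01 j).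
have pb : 0 <= p j / beta 0 j by rewrite divr_ge0// ltW.
apply: (@le_trans _ _ (p j / beta 0 j * (delta j * a j *
    (signr R (v j) * y 0 j <= 0)%R%:R))).
  by rewrite /gain le_eqVlt; apply/orP; left; apply/eqP; field; rewrite gt_eqF.
apply: (le_trans (ler_wpM2l pb h)).
rewrite le_eqVlt; apply/orP; left; apply/eqP.
have n2 : `|a j + a j| = 2 * a j by rewrite ger0_norm ?addr_ge0//; ring.
case: (v j); rewrite /signr !(mul1r, mulr1, mulN1r, mulrN1, opprK, subrr, normr0).
  by rewrite n2; field; rewrite gt_eqF.
rewrite addNr normr0 -opprD normrN n2.
by field; rewrite gt_eqF.
Qed.

Lemma coin_excess_risk_ge (X : set 'rV[R]_n) (k : nat)
    (xhat : seq ('rV[R]_n -> R) -> 'rV[R]_n) v : X (vertex v) ->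
  ((\sum_(s : k.-tuple ('I_n * bool))
      (\prod_(i < k) coin_weight p delta v (tnth s i)) *
      \sum_j gain j *
        (signr R (v j) * xhat (observed (coin_loss a) s) 0 j <= 0)%R%:R)%:E <=
   excess_risk X k (coin_loss a) (coin_law v) xhat)%E.
Proof.
move=> Xv.
have gap0 v' (y : 'rV[R]_n) :
    0 <= \sum_j gain j * (signr R (v' j) * y 0 j <= 0)%R%:R.
  by apply: sumr_ge0 => j _; rewrite mulr_ge0.
rewrite -(integral_iid_finite_probability (i0 := (j0, true)) (w0 v) (w1 v)
  (g := fun s => \sum_j gain j *
        (signr R (v j) * xhat (observed (coin_loss a) s) 0 j <= 0)%R%:R))//.
apply: ge0_le_integral => //.
- by move=> s _; rewrite lee_fin.
- exact: measurable_fun_discrete_tuple.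
- exact: measurable_fun_discrete_tuple.
move=> s _; apply: (@le_trans _ _ ((mean_loss v (xhat (observed (coin_loss a) s)))%:E
    - (mean_loss v (vertex v))%:E)%E).
  by rewrite -EFinB lee_fin; exact: mean_loss_gap.
rewrite expected_coin_loss leeB// -expected_coin_loss.
by apply: ereal_inf_lbound; exists (vertex v).
Qed.

(** The minimizer of the expected loss follows the hidden signs, and each sign that
the estimate misses costs [p_j delta_j a_j / beta_j]. *)
Lemma coin_lower_bound (X : set 'rV[R]_n) (k : nat) : (0 < k)%N ->
  (forall v, X (vertex v)) ->
  (forall j, k%:R * (p j * delta j ^+ 2) <= 4^-1) ->
  ((11 / 48 * \sum_j gain j)%:E <= minimax_stochastic_risk k X gamma)%E.
Proof.
move=> k0 XV kpd; apply: le_ereal_sup_tmp; eexists; first by exists _, coins.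
apply: le_ereal_inf_tmp => _ [xhat _ ->].
have [|v] := assouad (c := gain) (wrong := fun j b s =>
  (signr R b * xhat (observed (coin_loss a) (s : k.-tuple _)) 0 j <= 0)%R)
  k0 p0 p1 d01 kpd gain0.
  by move=> j s; rewrite /signr mul1r mulN1r oppr_le0; exact: le_total.
rewrite -lee_fin => /le_trans; apply; apply: (le_trans (coin_excess_risk_ge _ _ (XV v))).
apply: ereal_sup_ubound; exists (coin_loss a), (coin_law v); split=> //.
  exact: coin_loss_class.
by move=> y; exact: finite_probability_integrable.
Qed.

End risk.
End lower_bound.

Section rate.
Context (R : realType) (n : nat).

(** Sampling coordinates proportionally to [u_j ^ 2] would maximize
[\sum_j sqrt (p_j) u_j]; averaging with the uniform law costs a constant and
ensures that every coordinate is sampled often enough. *)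
Lemma sampling_weights (u : 'I_n -> R) : (0 < n)%N -> (forall j, 0 <= u j) ->
  exists p : 'I_n -> R,
  [/\ forall j, (2 * n%:R)^-1 <= p j, \sum_j p j = 1
    & 2 / 3 * Num.sqrt (\sum_j u j ^+ 2) <= \sum_j Num.sqrt (p j) * u j].
Proof.
move=> n0 u0; have nR : 0 < n%:R :> R by rewrite ltr0n.
have n1 : \sum_(j < n) n%:R^-1 = 1 :> R.
  by rewrite sumr_const card_ord -(mulr_natl n%:R^-1) mulfV// gt_eqF.
set U2 := \sum_j u j ^+ 2.
have U20 : 0 <= U2 by apply: sumr_ge0 => j _; exact: sqr_ge0.
have : 0 <= U2 by []; rewrite le_eqVlt => /predU1P[<-|Upos].
  exists (fun=> n%:R^-1); split=> // [j|].
    by rewrite lef_pV2 ?posrE ?mulr_gt0//; lra.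
  by rewrite sqrtr0 mulr0 sumr_ge0// => j _; rewrite mulr_ge0 ?sqrtr_ge0.
set U := Num.sqrt U2.
have U0 : 0 < U by rewrite sqrtr_gt0.
have UE : U2 = U * U by rewrite -expr2 sqr_sqrtr.
exists (fun j => (u j ^+ 2 / U2 + n%:R^-1) / 2); split.
- move=> j; have : 0 <= u j ^+ 2 / U2 by rewrite divr_ge0 ?sqr_ge0.
  by rewrite invfM; lra.
- by rewrite -mulr_suml big_split/= n1 -mulr_suml divff ?gt_eqF//; lra.
have sp j : 2 / 3 * (u j / U) <= Num.sqrt ((u j ^+ 2 / U2 + n%:R^-1) / 2).
  have h0 : 0 <= u j / U by rewrite divr_ge0// ltW.
  have z0 : 0 <= 2 / 3 * (u j / U) by rewrite mulr_ge0.
  (* (2 / 3) ^ 2 <= 1 / 2 *)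
  rewrite -[leLHS](ger0_norm z0) -sqrtr_sqr ler_wsqrtr//.
  have -> : u j ^+ 2 / U2 = (u j / U) ^+ 2.
    by rewrite UE; field; rewrite gt_eqF.
  have : 0 < n%:R^-1 :> R by rewrite invr_gt0.
  by have := sqr_ge0 (u j / U); rewrite !expr2; lra.
apply: (@le_trans _ _ (\sum_j 2 / 3 * (u j / U) * u j)); last first.
  by apply: ler_sum => j _; rewrite ler_wpM2r.
have -> : \sum_j 2 / 3 * (u j / U) * u j = 2 / 3 * (U2 / U).
  by rewrite [U2 / U]mulr_suml mulr_sumr; apply: eq_bigr => j _; ring.
by rewrite UE mulfK// gt_eqF.
Qed.

Context (r : R) (r0 : 0 < r) (beta : 'rV[R]_n) (b0 : forall j, 0 < beta 0 j).
Let gamma (g : 'rV[R]_n) := lr_norm r (hadamard beta g).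

Lemma lr_norm_res x :
  lr_norm 2 (res x gamma) = Num.sqrt (\sum_j (x 0 j / beta 0 j) ^+ 2).
Proof.
rewrite lr_norm2; congr Num.sqrt; apply: eq_bigr => j _.
rewrite mxE (_ : gamma (delta_mx 0 j) = beta 0 j)//.
rewrite /gamma (_ : hadamard _ _ = beta 0 j *: delta_mx 0 j).
  by rewrite lr_norm_delta// gtr0_norm.
apply/rowP => i; rewrite !mxE; have [->//|ij] := eqVneq i j.
by rewrite andbF !mulr0.
Qed.

(** An orthosymmetric set contains all sign changes of [x], hence all minimizers of
the coin losses with [a_j = `|x_j|]. For the bias that [k p_j] tosses cannot detect,
the loss per coordinate is of order [sqrt (p_j / k) `|x_j| / beta_j], and the
weights [p_j] turn the sum into a Euclidean norm. *)
Lemma minimax_stochastic_risk_ge (X : set 'rV[R]_n) (k : nat) x :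
  (0 < n)%N -> (2 * n <= k)%N -> orthosymmetric X -> X x ->
  ((16^-1 * ((Num.sqrt k%:R)^-1 * lr_norm 2 (res x gamma)))%:E <=
   minimax_stochastic_risk k X gamma)%E.
Proof.
move=> n0 kn oX Xx; have nR : 0 < n%:R :> R by rewrite ltr0n.
have k0 : (0 < k)%N by apply: leq_trans kn; rewrite muln_gt0.
have kR : 0 < k%:R :> R by rewrite ltr0n.
have sk : 0 < Num.sqrt k%:R :> R by rewrite sqrtr_gt0.
pose a j := `|x 0 j|.
have [|p [pn p1 pu]] := sampling_weights (u := fun j => a j / beta 0 j) n0.
  by move=> j; rewrite /a divr_ge0// ltW.
have pp j : 0 < p j by apply: lt_le_trans (pn j); rewrite invr_gt0 mulr_gt0.
have sp j : 0 < Num.sqrt (p j) by rewrite sqrtr_gt0.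
have sqp j : p j = Num.sqrt (p j) * Num.sqrt (p j) by rewrite -expr2 sqr_sqrtr// ltW.
have sqk : k%:R = Num.sqrt k%:R * Num.sqrt k%:R :> R by rewrite -expr2 sqr_sqrtr// ltW.
have kp1 j : 1 <= Num.sqrt k%:R * Num.sqrt (p j).
  rewrite -sqrtrM ?ler0n// -[leLHS](sqrtr1 R) ler_wsqrtr//.
  apply: (@le_trans _ _ (k%:R * (2 * n%:R)^-1)); last by rewrite ler_wpM2l.
  by rewrite ler_pdivlMr ?mulr_gt0// mul1r -natrM ler_nat.
(* the largest bias allowed by the condition k p_j delta_j ^ 2 <= 1 / 4 *)
pose delta j := (2 * (Num.sqrt k%:R * Num.sqrt (p j)))^-1.
have kpos j : 0 < Num.sqrt k%:R * Num.sqrt (p j) by rewrite mulr_gt0.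
have d01 j : 0 <= delta j <= 1.
  rewrite /delta invr_ge0 invf_le1 ?mulr_ge0 ?(ltW (kpos j)) ?mulr_gt0//=.
  by have := kp1 j; lra.
have kpd j : k%:R * (p j * delta j ^+ 2) <= 4^-1.
  rewrite {1}sqk {1}sqp /delta le_eqVlt; apply/orP; left; apply/eqP; field.
  by rewrite !gt_eqF.
have XV v : X (vertex a v).
  have -> : vertex a v = hadamard (\row_j (signr R (v j) * signr R (0 <= x 0 j))) x.
    apply/rowP => j; rewrite !mxE /a -mulrA; congr (_ * _).
    by rewrite /signr; case: ger0P => _; rewrite ?mul1r ?mulN1r.
  apply: oX => // j; rewrite mxE /signr.
  by case: (v j); case: (0 <= x 0 j); rewrite ?(mul1r, mulr1, mulrNN); auto.
apply: le_trans (coin_lower_bound (Ordinal n0) r0 b0 (fun j => normr_ge0 (x 0 j))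
  (fun j => ltW (pp j)) p1 d01 k0 XV kpd).
rewrite lee_fin lr_norm_res.
have -> : \sum_j (x 0 j / beta 0 j) ^+ 2 = \sum_j (a j / beta 0 j) ^+ 2.
  by apply: eq_bigr => j _; rewrite !expr_div_n real_normK ?num_real.
have -> : \sum_j p j * delta j * (`|x 0 j| / beta 0 j) =
          (2 * Num.sqrt k%:R)^-1 * \sum_j Num.sqrt (p j) * (a j / beta 0 j).
  rewrite mulr_sumr; apply: eq_bigr => j _.
  rewrite {1}sqp /delta /a; field; rewrite !gt_eqF//.
move: pu; set N := Num.sqrt _; set Sg := \sum_j _ * (_ / _) => pu.
have N0 : 0 <= N by exact: sqrtr_ge0.
have H0 : 0 <= (Num.sqrt k%:R)^-1 * N by rewrite mulr_ge0// invr_ge0 ltW.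
have : (Num.sqrt k%:R)^-1 * (2 / 3 * N) <= (Num.sqrt k%:R)^-1 * Sg.
  by rewrite ler_wpM2l// invr_ge0 ltW.
(* 11 / 48 * 1 / 2 * 2 / 3 = 11 / 144 >= 1 / 16 *)
rewrite invfM; lra.
Qed.

End rate.

(** * Bounds on the minimax risk and regret *)

Lemma compact_lr_norm_res (R : realType) (n : nat) (gamma : 'rV[R]_n -> R)
    (X : set 'rV[R]_n) :
  compact X -> exists M, forall x, X x -> lr_norm 2 (res x gamma) <= M.
Proof.
move=> /compact_bounded [M [_ XM]].
exists (Num.sqrt (\sum_j ((M + 1) / gamma (delta_mx 0 j)) ^+ 2)) => x Xx.
rewrite lr_norm2 ler_wsqrtr//; apply: ler_sum => j _.
rewrite mxE !expr_div_n ler_wpM2r ?invr_ge0 ?sqr_ge0//.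
rewrite -real_normK ?num_real// lerXn2r ?nnegrE//.
  by apply: le_trans (XM (M + 1) _ x Xx); rewrite ?normr_ge0 ?ltrDl.
have := XM (M + 1) _ x Xx; rewrite ltrDl => /(_ ltr01); apply: le_trans.
rewrite [leRHS]/Num.Def.normr/= mx_normrE.
exact: (@le_bigmax _ _ _ 0 (fun i => `|x i.1 i.2|) (0, j)).
Qed.

Lemma interior_exists_neq0 (R : realType) (n : nat) (X : set 'rV[R]_n) :
  (0 < n)%N -> X° !=set0 -> exists2 x, X x & exists j, x 0 j != 0.
Proof.
move=> n0 [c /nbhs_ballP[e /= e0 eX]]; pose j := Ordinal n0.
have [cj|cj] := eqVneq (c 0 j) 0; last first.
  by exists c; [apply: eX; exact: ballxx|exists j].
exists (c + const_mx (e / 2)).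
  apply: eX; split=> // i l; rewrite /ball/= !mxE opprD addrA subrr add0r normrN.
  by rewrite gtr0_norm ?divr_gt0// ltr_pdivrMr//; lra.
by exists j; rewrite !mxE cj add0r gt_eqF// divr_gt0.
Qed.

Theorem corollary9 (R : realType) (n : nat) (hn : (0 < n)%N)
  (X : set 'rV[R]_n) (X_neq0 : X !=set0) (X_orth : orthosymmetric X)
  (X_qconvex : quadratically_convex X) (X_convex : convex_set X)
  (X_compact : compact X)
  (r : R) (hr : 1 <= r <= 2) (beta : 'rV[R]_n) (hbeta : forall j, 0 < beta 0 j)
  (k : nat) (hk : (2 * n <= k)%N) :
  let gamma := fun g : 'rV[R]_n => lr_norm r (hadamard beta g) in
  let rate := (((Num.sqrt k%:R)^-1)%:E *
               ereal_sup [set (lr_norm 2 (res x gamma))%:E | x in X])%E in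
  [/\ ((16^-1)%:E * rate <= minimax_stochastic_risk k X gamma)%E,
      (minimax_stochastic_risk k X gamma <= minimax_regret k X gamma)%E,
      (minimax_regret k X gamma <= rate)%E
    & X° !=set0 ->
      exists lambda : 'rV[R]_n, (forall j, 0 < lambda 0 j) /\
        forall (d : measure_display) (T : measurableType d)
          (F : 'rV[R]_n -> T -> R) (s : k.-tuple T) (p : nat -> 'rV[R]_n),
          loss_class gamma T F -> scaled_gradient_run lambda F s p ->
          (average_regret X F s (fun i : 'I_k => p i) <= rate)%E].
Proof.
move=> gamma rate.
have r0 : 0 < r by have /andP[r1 _] := hr; exact: lt_le_trans r1.
have k0 : (0 < k)%N by apply: leq_trans hk; rewrite muln_gt0.
have sk : 0 < Num.sqrt k%:R :> R by rewrite sqrtr_gt0 ltr0n.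
have [x0 Xx0] := X_neq0.
have resE x := lr_norm_res r0 hbeta x.
have N0 x : 0 <= lr_norm 2 (res x gamma) by rewrite resE sqrtr_ge0.
have [M XM] := compact_lr_norm_res gamma X_compact.
set B := [set (lr_norm 2 (res x gamma))%:E | x in X] in rate *.
have BS x : X x -> ((lr_norm 2 (res x gamma))%:E <= ereal_sup B)%E.
  by move=> Xx; apply: ereal_sup_ubound; exists x.
have [S SE] : exists S, ereal_sup B = S%:E.
  exists (fine (ereal_sup B)); rewrite fineK// fin_numElt.
  rewrite (lt_le_trans _ (BS _ Xx0)) ?ltNyr//=.
  apply: (@le_lt_trans _ _ M%:E); last exact: ltry.
  by apply: ge_ereal_sup => _ [x Xx <-]; rewrite lee_fin XM.
have XS x : X x -> lr_norm 2 (res x gamma) <= S.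
  by move=> /BS; rewrite SE lee_fin.
have S0 : 0 <= S := le_trans (N0 x0) (XS x0 Xx0).
have rateE : rate = ((Num.sqrt k%:R)^-1 * S)%:E by rewrite /rate SE.
have XS2 x : X x -> \sum_j (x 0 j / beta 0 j) ^+ 2 <= S ^+ 2.
  move=> /XS; rewrite resE => h.
  by rewrite -[leLHS]sqr_sqrtr ?sumr_ge0 ?lerXn2r ?nnegrE ?sqrtr_ge0// => j _; exact: sqr_ge0.
have gb g : gamma g <= 1 -> \sum_j (beta 0 j * g 0 j) ^+ 2 <= 1.
  move=> /(lr_norm_le1 hr); under eq_bigr do rewrite mxE; exact.
pose lambda : 'rV[R]_n := \row_j (Num.sqrt k%:R / S / beta 0 j ^+ 2).
have regret d (T : measurableType d) (F : 'rV[R]_n -> T -> R) (s : k.-tuple T) p :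
    0 < S -> loss_class gamma T F -> scaled_gradient_run lambda F s p ->
    (average_regret X F s (fun i : 'I_k => p i) <= rate)%E.
  move=> Spos lF run; rewrite rateE.
  by apply: (@scaled_gradient_average_regret R n beta S k X gamma d T F s p).
split.
- have H x : X x -> ((16^-1 * ((Num.sqrt k%:R)^-1 * lr_norm 2 (res x gamma)))%:E <=
      minimax_stochastic_risk k X gamma)%E.
    exact: minimax_stochastic_risk_ge.
  rewrite rateE -EFinM.
  case: (minimax_stochastic_risk k X gamma) H => [m H|_|/(_ x0 Xx0)]; last 2 first.
  + exact: leey.
  + by rewrite leNgt ltNyr.
  rewrite lee_fin -ler_pdivlMl ?invr_gt0// -ler_pdivlMl ?invr_gt0//.
  rewrite -lee_fin -SE; apply: ge_ereal_sup => _ [x Xx <-].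
  by rewrite lee_fin ler_pdivlMl ?invr_gt0// ler_pdivlMl ?invr_gt0// -lee_fin H.
- exact: minimax_stochastic_risk_le_regret.
- apply: ge_ereal_sup => _ [d [T ->]].
  have := S0; rewrite [0 <= S]le_eqVlt => /predU1P[S00|Spos].
    (* X is reduced to the origin and the step sizes degenerate *)
    apply: ge_ereal_inf; eexists; first exists (fun=> 0) => //.
      by move=> i F _ j; exact: measurable_cst.
    apply: ge_ereal_sup => _ [F [s [lF ->]]].
    apply: ge_ereal_sup => _ [x Xx <-].
    have x0E : x = 0.
      apply/rowP => j; rewrite mxE; apply/eqP.
      have := XS2 x Xx; rewrite -S00 expr0n /= => h.
      have : \sum_j (x 0 j / beta 0 j) ^+ 2 == 0.
        by rewrite eq_le h sumr_ge0// => i _; exact: sqr_ge0.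
      rewrite psumr_eq0 => [/allP/(_ j)|i _]; last exact: sqr_ge0.
      rewrite mem_index_enum => /(_ isT); rewrite sqrf_eq0 mulf_eq0 invr_eq0.
      by rewrite [beta 0 j == 0]gt_eqF// orbF.
    by rewrite x0E rateE -S00 mulr0 big1 ?mulr0// => i _; rewrite subrr.
  apply: ge_ereal_inf; eexists; first exists (gradient_strategy lambda) => //.
    exact: gradient_strategy_online.
  apply: ge_ereal_sup => _ [F [s [lF ->]]].
  apply: (regret d T F s (fun i => gradient_strategy lambda (observed F (take i s)))) => //.
  exact: gradient_strategy_run lF.
- move=> /(interior_exists_neq0 hn)[x Xx [j xj]].
  have Spos : 0 < S.
    apply: lt_le_trans (XS x Xx); rewrite resE sqrtr_gt0 (bigD1 j)//=.
    rewrite ltr_pwDl ?sumr_ge0// => [|i _]; last exact: sqr_ge0.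
    by rewrite exprn_even_gt0//= mulf_neq0// invr_neq0// gt_eqF.
  exists lambda; split=> [i|d T F s p lF run]; last exact: regret.
  by rewrite mxE !divr_gt0// exprn_gt0.
Qed.
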